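(* Let $k\ge 3$ and $n\ge 2^k$ be integers. The following conditions are equivalent: (a) $b_{2^k-1}(n)$ is not a sum of three squares; (b) $t_n=t_{n-2^k}=1$; (c) $n=2^k m+l$, where $l,m\in\mathbb{N}$ are such that $l<2^k$, $t_m=t_l$, and $\nu_2(m)\equiv 1\pmod 2$.
   Context: $\mathbb{N}$ is the set of non-negative integers. For a positive integer $m$, $b_m(n)$ is the number of partitions of $n$ into powers of two where each part has one of $m$ colors, i.e. $\sum_{n\ge 0} b_m(n)x^n=\prod_{j\ge 0}(1-x^{2^j})^{-m}$. An integer $N$ is a sum of three squares if $N=x^2+y^2+z^2$ for some $x,y,z\in\mathbb{Z}$ (zero allowed). The Prouhet-Thue-Morse sequence is $t_n=(-1)^{s_2(n)}$, where $s_2(n)$ is the number of digits $1$ in the binary expansion of $n$. $\nu_2(m)$ is the $2$-adic valuation of $m$ (the largest $e$ with $2^e\mid m$), with $\nu_2(0)=+\infty$. *)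

(* Defs.v *)
From mathcomp Require Import all_boot all_order all_algebra.

Set Implicit Arguments.
Unset Strict Implicit.
Unset Printing Implicit Defensive.

Import GRing.Theory.

(* A partition of n into powers of two, each part having one of m colors, is
   recorded by its multiplicities: f (j, c) is the number of parts equal to
   2 ^ j with color c.  The bounds lose nothing, since 2 ^ j <= n forces j < n
   and no part can occur more than n times. *)
Definition colored_binary_partitions (m n : nat) :
    {set {ffun 'I_n.+1 * 'I_m -> 'I_n.+1}} :=
  [set f : {ffun 'I_n.+1 * 'I_m -> 'I_n.+1} |
     \sum_(p : 'I_n.+1 * 'I_m) f p * 2 ^ p.1 == n].

Definition b (m n : nat) : nat := #|colored_binary_partitions m n|.

Definition sum_of_three_squares (N : nat) : Prop :=
  exists x y z : int, (N%:Z = x ^+ 2 + y ^+ 2 + z ^+ 2)%R.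

(* The digits of index i >= n vanish because n < 2 ^ n. *)
Definition s2 (n : nat) : nat := \sum_(i < n) (n %/ 2 ^ i) %% 2.

Definition t (n : nat) : int := ((-1) ^+ s2 n)%R.

(* Main.v *)
Require Import Defs.
From mathcomp Require Import all_boot all_order all_algebra.
From mathcomp Require Import zify ring lra.

Set Implicit Arguments.
Unset Strict Implicit.
Unset Printing Implicit Defensive.

Import Order.TTheory GRing.Theory Num.Theory.

(** Let B(x) be the generating function of binary partitions and T = 1/B that of t.
    Since T(x) = (1 - x) T(x^2), induction gives T^2 (1 - x)^3 = 1 + 3 x modulo 8;
    raising this to powers of two shows that b_{2^k-1}(n), n >= 2^k, is modulo 32 the
    coefficient of x^n in (1 - x)^(2^k) T.  Halving n and k reduces to k = 3, where the
    residue is - 4 t_n if t_n = t_{n-2^k}, and is 2 modulo 4 otherwise.  Hence b is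
    4 (8 j + 7), 4 (8 j + 1) or 4 j + 2, and it remains to represent the integers
    1 modulo 4 and 2 modulo 4 by three squares.

    This is done without Dirichlet's theorem, by an explicit positive formula.  Let psi
    and phi be the theta series of the positive odd squares and of the signed even
    squares.  A sign-reversing involution proves Jacobi's formula: psi(x)^4 has
    coefficient sigma(M) at 4 M for M odd, so (psi phi)^2, which is psi^4 after
    x -> x^2, has coefficient sigma(M) at 2 M.  On the other hand count the forms
    a X^2 + 2 J X Y + C Y^2 with a C - J^2 = N, a, C odd and |J| < min(a, C) (boundary
    forms having weight 1/2).  Multiplying by psi or phi the generating function of
    these counts gives the same divisor sum (Kronecker's class number relation), so the
    counts are the coefficients of psi phi^2 and psi^2 phi, up to the factor 2; and they
    are positive, because a = 1 always contributes (for N <> 2). *)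

(** * Reindexing of finite sums, and boxes of integers *)

Section SeqSums.
Local Open Scope ring_scope.

Lemma big_seq_bij (V : nmodType) (I J : eqType) (s : seq I) (s' : seq J)
    (P : pred I) (Q : pred J) (f : I -> J) (g : J -> I) (F : I -> V) (G : J -> V) :
  uniq s -> uniq s' ->
  (forall i, i \in s -> P i -> [/\ f i \in s', Q (f i), g (f i) = i & F i = G (f i)]) ->
  (forall j, j \in s' -> Q j -> [/\ g j \in s, P (g j) & f (g j) = j]) ->
  \sum_(i <- s | P i) F i = \sum_(j <- s' | Q j) G j.
Proof.
move=> us us' Hf Hg.
rewrite -big_filter -[RHS]big_filter.
rewrite (eq_big_seq (fun i => G (f i))); last first.
  by move=> i; rewrite mem_filter => /andP[Pi si]; have [] := Hf i si Pi.
rewrite -(big_map f xpredT G); apply: perm_big; apply: uniq_perm.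
- rewrite map_inj_in_uniq ?filter_uniq // => i j.
  rewrite !mem_filter => /andP[Pi si] /andP[Pj sj] e.
  have [_ _ gi _] := Hf i si Pi; have [_ _ gj _] := Hf j sj Pj.
  by rewrite -gi -gj e.
- by rewrite filter_uniq.
move=> j; apply/mapP/idP => [[i]|].
  rewrite !mem_filter => /andP[Pi si] ->.
  by have [-> -> _ _] := Hf i si Pi.
rewrite mem_filter => /andP[Qj sj]; have [gs Pg fg] := Hg j sj Qj.
by exists (g j); rewrite ?mem_filter ?Pg.
Qed.

Lemma mem_pairs (I J : eqType) (s : seq I) (s' : seq J) (p : I * J) :
  (p \in [seq (i, j) | i <- s, j <- s']) = (p.1 \in s) && (p.2 \in s').
Proof.
apply/allpairsP/andP => [[[i j] /= [si sj ->]] // | [s1 s2]].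
by exists p; case: p s1 s2.
Qed.

Lemma uniq_pairs (I J : eqType) (s : seq I) (s' : seq J) :
  uniq s -> uniq s' -> uniq [seq (i, j) | i <- s, j <- s'].
Proof. by move=> us us'; apply: allpairs_uniq => // -[? ?] [? ?]. Qed.

Definition zrange (B : nat) : seq int :=
  0 :: [seq Posz j.+1 | j <- iota 0 B] ++ [seq Negz j | j <- iota 0 B].

Lemma mem_zrange B x : (x \in zrange B) = (- B%:Z <= x <= B%:Z).
Proof.
rewrite /zrange inE mem_cat; apply/idP/idP => [/or3P[/eqP -> | | ] | ].
- by lia.
- by case/mapP=> j; rewrite mem_iota => hj ->; lia.
- by case/mapP=> j; rewrite mem_iota => hj ->; lia.
case: x => [[|j]|j] // h; apply/orP; right; apply/orP.
  by left; apply/mapP; exists j; rewrite ?mem_iota; lia.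
by right; apply/mapP; exists j; rewrite ?mem_iota; lia.
Qed.

Lemma uniq_zrange B : uniq (zrange B).
Proof.
rewrite /zrange /= mem_cat cat_uniq !map_inj_uniq ?iota_uniq; try by move=> i j [].
rewrite andbT; apply/andP; split.
  by apply/negP => /orP[] /mapP[].
by apply/hasPn => x /mapP[j _ ->]; apply/negP => /mapP[].
Qed.

Lemma sum_zrange (V : nmodType) B (g : nat -> V) :
  \sum_(y <- zrange B) g (absz y) = g 0%N + (\sum_(j < B) g j.+1) *+ 2.
Proof.
rewrite /zrange big_cons big_cat !big_map /= mulr2n.
have -> : iota 0 B = index_iota 0 B by rewrite /index_iota subn0.
by rewrite !big_mkord.
Qed.

Definition zbox (B : nat) : seq (int * int * int) :=
  [seq (p, e) | p <- [seq (x, d) | x <- zrange B, d <- zrange B], e <- zrange B].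

Lemma mem_zbox B x d e : ((x, d, e) \in zbox B) =
  [&& - B%:Z <= x <= B%:Z, - B%:Z <= d <= B%:Z & - B%:Z <= e <= B%:Z].
Proof. by rewrite !mem_pairs !mem_zrange /= -andbA. Qed.

Lemma uniq_zbox B : uniq (zbox B).
Proof. by rewrite !uniq_pairs ?uniq_zrange. Qed.

Lemma int_parity (x : int) : (exists y, x = 2 * y) \/ (exists y, x = 2 * y + 1).
Proof.
have [h|h] : (x %% 2)%Z = 0 \/ (x %% 2)%Z = 1 by lia.
  by left; exists (x %/ 2)%Z; lia.
by right; exists (x %/ 2)%Z; lia.
Qed.

Lemma odd_sqr (x y : int) : x = 2 * y + 1 -> exists z, x ^+ 2 = 8 * z + 1.
Proof.
move=> ->; have [[z ->]|[z ->]] := int_parity y.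
  by exists (2 * z ^+ 2 + z); ring.
by exists (2 * z ^+ 2 + 3 * z + 1); ring.
Qed.

End SeqSums.

Arguments zrange : simpl never.

(** * Sums of four odd squares *)

Section FourOddSquares.
Local Open Scope ring_scope.
Implicit Types (R x d e : int) (p : int * int * int).

(** For fixed x the pairs (d, e) are the factorizations of (R - x^2) / 4, so weights in d produce
    divisor sums. *)
Definition sol R p : bool :=
  let: (x, d, e) := p in [&& x ^+ 2 + 4 * (d * e) == R, 0 < d & 0 < e].

Lemma sol_bound B R x d e : R <= B%:Z -> sol R (x, d, e) ->
  (x, d, e) \in zbox B.
Proof.
rewrite mem_zbox => RB /and3P[/eqP eqR d0 e0].
have x2 : 0 <= x ^+ 2 by rewrite sqr_ge0.
have dd : d <= d * e by nia.
have ee : e <= d * e by nia.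
have : `|x| <= x ^+ 2 by nia.
lia.
Qed.

Variables (r B : nat).
Let R : int := 8 * r%:Z + 5.
Hypothesis RB : R <= B%:Z.

Lemma sum_sol_bij (P Q : pred (int * int * int)) f g (F G : int * int * int -> int) :
  (forall p, sol R p -> P p -> [/\ sol R (f p), Q (f p), g (f p) = p & F p = G (f p)]) ->
  (forall p, sol R p -> Q p -> [/\ sol R (g p), P (g p) & f (g p) = p]) ->
  \sum_(p <- zbox B | sol R p && P p) F p = \sum_(p <- zbox B | sol R p && Q p) G p.
Proof.
move=> Hf Hg; apply: (big_seq_bij (f := f) (g := g)); rewrite ?uniq_zbox //.
  move=> p _ /andP[sp Pp]; have [h1 h2 h3 h4] := Hf p sp Pp.
  split=> //; last by apply/andP.
  by case: (f p) h1 => [[x d] e]; apply: sol_bound.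
move=> p _ /andP[sp Qp]; have [h1 h2 h3] := Hg p sp Qp.
split=> //; last by apply/andP.
by case: (g p) h1 => [[x d] e]; apply: sol_bound.
Qed.

(** As R is odd, so is x; then x^2 = 1 and R = 5 modulo 8 leave 4 d e = 4 modulo 8, so d e is
    odd. *)
Lemma sol_odd x d e : sol R (x, d, e) ->
  exists x' d' e', [/\ x = 2 * x' + 1, d = 2 * d' + 1 & e = 2 * e' + 1].
Proof.
clear RB; move=> /and3P[/eqP + _ _]; rewrite /R => H.
have [[x' hx]|[x' hx]] := int_parity x.
  by exfalso; move: H; rewrite hx exprMn; lia.
have [z hz] := odd_sqr hx.
have [[d' hd]|[d' hd]] := int_parity d.
  by exfalso; move: H; rewrite hz hd -mulrA; lia.
have [[e' he]|[e' he]] := int_parity e.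
  by exfalso; move: H; rewrite hz he [d * _]mulrCA; lia.
by exists x', d', e'.
Qed.

Let Sol P F := \sum_(p <- zbox B | sol R p && P p) F p : int.

(** [up] is the domain of the involution below. G is chosen to become F when x is replaced by 2 d +
    x, as in [sum_down], which maps the complement of [up] onto [low]. *)
Let F p : int := let: (x, d, e) := p in (e - x) * (2 * d + x) ^+ 2.
Let G p : int := let: (x, d, e) := p in (d + e) * x ^+ 2.
Let up p := let: (x, d, e) := p in 0 < d + x - e.
Let low p := let: (x, d, e) := p in 0 < x - d + e.

(* The involution keeps 2 d + x and changes the sign of e - x. *)
Lemma sum_up : Sol up F = 0.
Proof.
pose f p := let: (x, d, e) := p in (2 * e - x, d - e + x, e).
suff : Sol up F = Sol up (fun p => - F p).
  by rewrite {2}/Sol sumrN -/(Sol up F); move: (Sol up F) => z; lia.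
have fK p : f (f p) = p by case: p => [[x d] e]; rewrite /f; do 2?congr pair; ring.
have fS p : sol R p -> up p -> sol R (f p) && up (f p).
  case: p => [[x d] e] /and3P[/eqP e1 d0 e0] /= h.
  have -> : (2 * e - x) ^+ 2 + 4 * ((d - e + x) * e) = R by rewrite -e1; ring.
  by rewrite eqxx e0 /=; apply/andP; split; lia.
apply: (sum_sol_bij (f := f) (g := f)) => p sp up_p; have /andP[h1 h2] := fS p sp up_p.
  by split=> //; case: (p) => [[x d] e]; rewrite /f /F; ring.
by split.
Qed.

Lemma sum_down : Sol (predC up) F = Sol low G.
Proof.
pose f p := let: (x, d, e) := p in (2 * d + x, d, e - x - d).
pose g p := let: (x, d, e) := p in (x - 2 * d, d, x - d + e).
apply: (sum_sol_bij (f := f) (g := g)) => -[[x d] e] sp.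
  have [x' [d' [e' [hx hd he]]]] := sol_odd sp.
  move: sp => /and3P[/eqP e1 d0 e0] /= h; split.
  - have -> : (2 * d + x) ^+ 2 + 4 * (d * (e - x - d)) = R by rewrite -e1; ring.
    by rewrite eqxx d0 /=; lia.
  - by lia.
  - by do 2?congr pair; ring.
  - by ring.
move: sp => /and3P[/eqP e1 d0 e0] /= h; split.
- have -> : (x - 2 * d) ^+ 2 + 4 * (d * (x - d + e)) = R by rewrite -e1; ring.
  by rewrite eqxx d0 h.
- by rewrite -leNgt; lia.
- by do 2?congr pair; ring.
Qed.

(** The map preserves G and changes the sign of x - d + e, which is odd and thus never zero. *)
Lemma sum_low : Sol low G = Sol (predC low) G.
Proof.
pose f p := let: (x, d, e) := p in (- x, e, d) : int * int * int.
apply: (sum_sol_bij (f := f) (g := f)) => -[[x d] e] sp.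
  have [x' [d' [e' [hx hd he]]]] := sol_odd sp.
  move: sp => /and3P[/eqP e1 d0 e0] /= h; split; rewrite ?opprK //.
  - by rewrite d0 e0 sqrrN [e * d]mulrC e1 eqxx.
  - by lia.
  - by ring.
have [x' [d' [e' [hx hd he]]]] := sol_odd sp.
move: sp => /and3P[/eqP e1 d0 e0] /= h; split; rewrite ?opprK //.
- by rewrite d0 e0 sqrrN [e * d]mulrC e1 eqxx.
- by lia.
Qed.

Lemma sum_solC P H : Sol xpredT H = Sol P H + Sol (predC P) H.
Proof.
rewrite /Sol (bigID P) /=; congr (_ + _).
  by apply: eq_bigl => p; rewrite andbT.
by apply: eq_bigl => p; rewrite andbT.
Qed.

Lemma sum_sol_neg H : Sol xpredT H = Sol xpredT (fun p => let: (x, d, e) := p in H (- x, d, e)).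
Proof.
pose f p := let: (x, d, e) := p in (- x, d, e) : int * int * int.
by apply: (sum_sol_bij (f := f) (g := f)) => -[[x d] e] sp _; split;
  rewrite /= ?opprK ?sqrrN.
Qed.

Lemma sum_sol_swap H : Sol xpredT H = Sol xpredT (fun p => let: (x, d, e) := p in H (x, e, d)).
Proof.
pose f p := let: (x, d, e) := p in (x, e, d) : int * int * int.
apply: (sum_sol_bij (f := f) (g := f)) => -[[x d] e] /and3P[h1 h2 h3] _; split;
  by rewrite /= ?[e * d]mulrC ?h1 ?h2 ?h3.
Qed.

(** The previous lemmas make 2 F - G sum to 0. Symmetrized under x -> -x and under the exchange of d
    and e, it becomes 16 (d + e) (d e - x^2), and by symmetry d counts for half of d + e. *)
Lemma sum_sol_weight :
  \sum_(p <- zbox B | sol R p) (let: (x, d, e) := p in d * (d * e - x ^+ 2)) = 0 :> int.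
Proof.
pose D p : int := let: (x, d, e) := p in d * (d * e - x ^+ 2).
pose A p : int := 2 * F p - G p.
have SE H : \sum_(p <- zbox B | sol R p) H p = Sol xpredT H.
  by apply: eq_bigl => p; rewrite andbT.
have A0 : Sol xpredT A = 0.
  rewrite /A /Sol sumrB -mulr_sumr -/(Sol xpredT F) -/(Sol xpredT G).
  by rewrite (sum_solC up F) (sum_solC low G) sum_up sum_down -sum_low; ring.
have DD : Sol xpredT D + Sol xpredT D = Sol xpredT (fun p => let: (x, d, e) := p in
    (d + e) * (d * e - x ^+ 2)).
  rewrite {2}sum_sol_swap /Sol -big_split /=; apply: eq_bigr => -[[x d] e] _.
  by rewrite /D; ring.
have : Sol xpredT (fun p => let: (x, d, e) := p in
     16 * ((d + e) * (d * e - x ^+ 2))) = 0.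
  pose A' p : int := let: (x, d, e) := p in A (x, d, e) + A (- x, d, e).
  have A1 : Sol xpredT A' = 0.
    transitivity (Sol xpredT A + Sol xpredT (fun p => let: (x, d, e) := p in A (- x, d, e))).
      by rewrite /Sol -big_split; apply: eq_bigr => -[[x d] e].
    by rewrite -sum_sol_neg A0 addr0.
  transitivity (Sol xpredT A' + Sol xpredT (fun p => let: (x, d, e) := p in A' (x, e, d))).
    rewrite /Sol -big_split; apply: eq_bigr => -[[x d] e] _.
    by rewrite /A' /A /=; ring.
  by rewrite -sum_sol_swap A1 addr0.
rewrite {1}/Sol (eq_bigr (fun p => 16 * (let: (x, d, e) := p in
    (d + e) * (d * e - x ^+ 2)))) -?mulr_sumr; last by move=> [[x d] e].
rewrite SE -/D; move: DD; rewrite /Sol => <-.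
by lia.
Qed.

Lemma sum_sol_pos :
  \sum_(p <- zbox B | sol R p && (0 < p.1.1)) (let: (x, d, e) := p in d * (d * e - x ^+ 2)) = 0.
Proof.
pose D p : int := let: (x, d, e) := p in d * (d * e - x ^+ 2).
have H0 : Sol xpredT D = 0.
  by rewrite -[RHS]sum_sol_weight; apply: eq_bigl => p; rewrite andbT.
pose f p := let: (x, d, e) := p in (- x, d, e) : int * int * int.
have : Sol (fun p => 0 < p.1.1) D = Sol (predC (fun p => 0 < p.1.1)) D.
  apply: (sum_sol_bij (f := f) (g := f)) => -[[x d] e] sp /= h;
    have [x' [_ [_ [hx _ _]]]] := sol_odd sp; rewrite ?opprK ?sqrrN; split=> //; lia.
move: H0; rewrite (sum_solC (fun p => 0 < p.1.1)) => + e; rewrite -e -/(Sol _ D).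
by move: (Sol _ D) => z; lia.
Qed.

End FourOddSquares.

Section WeightedSum.
Local Open Scope ring_scope.

Lemma odd_weighted_sum (L R : nat) : (R <= L)%N ->
  \sum_(j < L) \sum_(i < L) \sum_(c < L)
    ((2 * j + 1) ^ 2 + 4 * ((2 * i + 1) * (2 * c + 1)) == R)%N%:R *
    ((2 * i%:Z + 1) * ((2 * i%:Z + 1) * (2 * c%:Z + 1) - (2 * j%:Z + 1) ^+ 2)) = 0.
Proof.
move=> RL.
have [[r hr]|nR] : (exists r, R = 8 * r + 5)%N \/ (R %% 8 != 5)%N.
- by case: (altP (R %% 8 =P 5)%N) => h; [left; exists (R %/ 8)%N; lia | right].
- case: L RL => [|L] RL; first by rewrite big_ord0.
  rewrite pair_big pair_big /= -[RHS](@sum_sol_pos r L.+1); last by lia.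
  under eq_bigr do rewrite mulr_natl mulrb.
  rewrite -big_mkcond /=.
  pose f (p : 'I_L.+1 * 'I_L.+1 * 'I_L.+1) : int * int * int :=
    (2 * p.1.1%:Z + 1, 2 * p.1.2%:Z + 1, 2 * p.2%:Z + 1).
  pose h (x : int) : 'I_L.+1 := inord (absz (x - 1))./2.
  pose g (p : int * int * int) := (h p.1.1, h p.1.2, h p.2).
  apply: (big_seq_bij (f := f) (g := g)); rewrite ?index_enum_uniq ?uniq_zbox //.
    move=> [[j i] c] _ /= /eqP e.
    have s : sol (8 * r%:Z + 5) (f (j, i, c)).
      apply/and3P; split; rewrite /=; [apply/eqP | lia | lia].
      have -> : 8 * r%:Z + 5 = R by lia.
      by rewrite -e; lia.
    split=> //.
    - by apply: sol_bound s; lia.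
    - by apply/andP; split; [exact: s | rewrite /=; lia].
    - rewrite /g /f /h /=; congr (_, _, _); apply: val_inj; rewrite /= inordK; lia.
  move=> [[x d] e] hb /andP[s x0].
  have [x' [d' [e' [hx hd he]]]] := @sol_odd r x d e s.
  move: s => /and3P[/eqP s d0 e0] /=; move: x0 => /= x0.
  rewrite mem_zbox in hb.
  have hK (y y' : int) : y = 2 * y' + 1 -> 0 < y -> y <= L.+1%:Z -> 2 * (h y)%:Z + 1 = y.
    by move=> hy y0 yL; rewrite /h inordK; lia.
  have [kx kd ke] : [/\ 2 * (h x)%:Z + 1 = x, 2 * (h d)%:Z + 1 = d & 2 * (h e)%:Z + 1 = e].
    by split; [apply: (hK _ x') | apply: (hK _ d') | apply: (hK _ e')]; lia.
  split; first by rewrite mem_index_enum.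
    rewrite /g /=; apply/eqP.
    have : x ^+ 2 + 4 * (d * e) = R by rewrite s; lia.
    move: (h x) (h d) (h e) kx kd ke => u v w kx kd ke.
    by rewrite -kx -kd -ke; lia.
  by rewrite /f /g /= kx kd ke.
(* Here R is not 5 modulo 8, while an odd square plus four times an odd number always is; so every
   indicator is 0. *)
apply: big1 => j _; apply: big1 => i _; apply: big1 => c _.
case: eqP => [e|_]; last by rewrite mul0r.
exfalso; move/eqP: nR; apply; rewrite -e.
have : ~~ odd (j * j.+1) by rewrite oddM /=; case: (odd j).
by move=> h; have := even_halfK h; lia.
Qed.
End WeightedSum.

(** * Kronecker's relation *)

Section ClassNumber.
Local Open Scope ring_scope.

Lemma sum_shift (B : nat) (g : nat -> int) :
  \sum_(i < B) g i.+1 = \sum_(i < B) g i - g 0%N + g B.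
Proof.
rewrite addrAC -(big_ord_recr B (fun i : 'I_B.+1 => g i)) big_ord_recl /=.
by rewrite addrC addKr.
Qed.

Lemma sum_shiftn (B n : nat) (g : nat -> int) :
  (forall j, (B <= j)%N -> g j = 0) ->
  \sum_(i < B) g (i + n)%N = \sum_(i < B) g i - \sum_(i < n) g i.
Proof.
move=> g0; elim: n => [|n IHn].
  by rewrite big_ord0 subr0; under eq_bigr do rewrite addn0.
under eq_bigr do rewrite addnS -addSn.
rewrite (sum_shift _ (fun i => g (i + n)%N)) IHn big_ord_recr /= (g0 (B + n)%N) ?leq_addr //.
by rewrite add0n; ring.
Qed.

Fixpoint jcount_nat (t : nat) (v : int) : int :=
  match t with
  | 0 => 0
  | 1 => (v == 0)%:R
  | (t'.+1 as s).+1 => jcount_nat t' v + 2 * (s%:Z ^+ 2 == v)%:R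
  end.

(* The sign of t times the number of J with |J| < |t|, J <> t (mod 2) and J ^ 2 = v. *)
Definition jcount (t v : int) : int :=
  match t with Posz n => jcount_nat n v | Negz n => - jcount_nat n.+1 v end.

Lemma jcountN t v : jcount (- t) v = - jcount t v.
Proof.
case: t => [[|n]|n]; last by rewrite NegzE opprK /= opprK.
  by [].
by rewrite -NegzE.
Qed.

(** The odd extension of the count to negative t makes this recurrence hold at every integer, t = 0
    included. *)
Lemma jcount_step t v : jcount (t + 1) v = jcount (t - 1) v + 2 * (t ^+ 2 == v)%:R.
Proof.
have pos n w : jcount (n.+1%:Z + 1) w = jcount (n.+1%:Z - 1) w + 2 * (n.+1%:Z ^+ 2 == w)%:R.
  have -> : n.+1%:Z + 1 = n.+2 by lia.
  by have -> : n.+1%:Z - 1 = n by lia.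
case: t => [[|n]|n]; first by rewrite /= eq_sym expr0n /=; case: eqP.
  exact: pos.
have -> : Negz n + 1 = - (n.+1%:Z - 1) by lia.
have -> : Negz n - 1 = - (n.+1%:Z + 1) by lia.
by rewrite !jcountN pos NegzE sqrrN; ring.
Qed.

Lemma jcount_nat_ge0 t v : 0 <= jcount_nat t v.
Proof.
suff : 0 <= jcount_nat t v /\ 0 <= jcount_nat t.+1 v by case.
elim: t => [|t [IH1 IH2]]; first by split=> //=; case: eqP.
by split=> //=; apply: addr_ge0 => //; case: eqP.
Qed.

Lemma jcount_ge0 t v : 0 <= t -> 0 <= jcount t v.
Proof. by case: t => // n _; apply: jcount_nat_ge0. Qed.

Lemma jcount_nat_eq0 (t : nat) v : (t.-1%:Z) ^+ 2 < v -> jcount_nat t v = 0.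
Proof.
elim/ltn_ind: t => -[|[|t]] IH //=; first by case: eqP => // ->; rewrite expr0n.
move=> h; rewrite IH //; first by case: eqP => [e|//]; move: h; rewrite e ltxx.
by apply: le_lt_trans h; rewrite !expr2; apply: ler_pM; lia.
Qed.

Lemma jcount_eq0 t v : 0 < t -> (t - 1) ^+ 2 < v -> jcount t v = 0.
Proof.
case: t => // -[|n] // _; have -> : n.+1%:Z - 1 = n by lia.
by move=> h; apply: jcount_nat_eq0.
Qed.

Lemma jcount_sqr_eq0 t v : t ^+ 2 <= v -> jcount t v = 0.
Proof.
have pos n w : n%:Z ^+ 2 <= w -> jcount n w = 0.
  case: n => [|n] // h; apply: jcount_nat_eq0.
  by apply: lt_le_trans h; rewrite !expr2; nia.
case: t => n; first exact: pos.
by rewrite NegzE jcountN sqrrN => h; rewrite pos // oppr0.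
Qed.

Variable B : nat.

Let a (i : nat) : int := 2 * i%:Z + 1.

(* For B large, k = 0 and N = 1 modulo 4, or k = 1 and N = 2 modulo 4, this is the
   weighted number of forms with a C - J ^ 2 = N described at the top of the file; the two
   summands come from C = a + 4 c - 2 k and, after exchanging a and C, C = a + 2 k + 4 (c + 1).
   Other values of k correspond to moving the variable of the elliptic functions behind
   the identity: only the parity of k matters, so k can be adapted to N in a sum over N. *)
Definition form_count (k : nat) (N : int) : int := \sum_(i < B) \sum_(c < B)
  (jcount (a i - k%:Z) (a i * (a i + 4 * c%:Z - 2 * k%:Z) - N) +
   jcount (a i + k%:Z) (a i * (a i + 2 * k%:Z + 4 * (c%:Z + 1)) - N)).

(** On the left the arguments start at 1 - k in steps of 2. Those from 1 - k to k - 1 cancel in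
    opposite pairs, and the others are those of the right-hand side; the vanishing of [eta] absorbs
    the different upper ends. *)
Lemma sum_odd_fun (eta : int -> int) (k : nat) :
  (forall t, eta (- t) = - eta t) ->
  (forall t, 2 * B%:Z + 1 - k%:Z <= t -> eta t = 0) ->
  \sum_(i < B) eta (a i - k%:Z) = \sum_(i < B) eta (a i + k%:Z).
Proof.
move=> etaN; elim/ltn_ind: k => -[|[|k]] IH eta0.
- by apply: eq_bigr => i _; congr eta; lia.
- have := sum_shift B (fun i => eta (2 * i%:Z)).
  rewrite (eta0 (2 * B%:Z)); last by lia.
  have -> : eta (2 * 0%N%:Z) = 0.
    by rewrite mulr0; have := etaN 0; rewrite oppr0; move: (eta 0) => z; lia.
  rewrite subr0 addr0 => e.
  transitivity (\sum_(i < B) eta (2 * i%:Z)).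
    by apply: eq_bigr => i _; congr eta; rewrite /a; lia.
  by rewrite -e; apply: eq_bigr => i _; congr eta; rewrite /a; lia.
have e1 := sum_shift B (fun i => eta (a i - k.+2%:Z)).
have e2 := sum_shift B (fun i => eta (a i + k%:Z)).
rewrite (eta0 (a B - k.+2%:Z)) /= in e1; last by rewrite /a; lia.
rewrite (eta0 (a B + k%:Z)) /= in e2; last by rewrite /a; lia.
have {}e1 : \sum_(i < B) eta (a i - k.+2%:Z) = \sum_(i < B) eta (a i - k%:Z) + eta (a 0%N - k.+2%:Z).
  have -> : \sum_(i < B) eta (a i - k%:Z) = \sum_(i < B) eta (a i.+1 - k.+2%:Z).
    by apply: eq_bigr => i _; congr eta; rewrite /a; lia.
  by rewrite e1; ring.
rewrite e1 IH //; last by move=> t ht; apply: eta0; lia.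
have -> : \sum_(i < B) eta (a i + k.+2%:Z) = \sum_(i < B) eta (a i.+1 + k%:Z).
  by apply: eq_bigr => i _; congr eta; rewrite /a; lia.
rewrite e2 addr0; congr (_ + _); rewrite -etaN; congr eta; rewrite /a; lia.
Qed.

(** For fixed i the two summands are shifted by one step in c, in opposite directions. This leaves
    boundary terms at c = 0, values of the odd function [eta], which [sum_odd_fun] cancels in the
    sum over i; the size of B makes the terms at c = B vanish. *)
Lemma form_count_step (k : nat) (N : int) :
  (k%:Z + 3) ^+ 2 + N <= 4 * B%:Z + 1 -> form_count k.+2 N = form_count k N.
Proof.
move=> hB; rewrite /form_count.
set K : int := (k%:Z + 2) ^+ 2 + N.
have hK : K + 2 * k%:Z + 4 <= 4 * B%:Z by rewrite /K; move: hB; rewrite !expr2; lia.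
pose eta t := jcount t (t ^+ 2 - K).
have inner (i : 'I_B) :
  \sum_(c < B) (jcount (a i - k.+2%:Z) (a i * (a i + 4 * c%:Z - 2 * k.+2%:Z) - N) +
     jcount (a i + k.+2%:Z) (a i * (a i + 2 * k.+2%:Z + 4 * (c%:Z + 1)) - N)) =
  \sum_(c < B) (jcount (a i - k%:Z) (a i * (a i + 4 * c%:Z - 2 * k%:Z) - N) +
   jcount (a i + k%:Z) (a i * (a i + 2 * k%:Z + 4 * (c%:Z + 1)) - N)) +
  (eta (a i - k.+2%:Z) - eta (a i + k.+2%:Z)).
  have a1 : 1 <= a i by rewrite /a; lia.
  pose g1 (c : nat) := jcount (a i - k.+2%:Z) (a i * (a i + 4 * (c%:Z - 1) - 2 * k%:Z) - N).
  pose g2 (c : nat) := jcount (a i + k.+2%:Z) (a i * (a i + 2 * k%:Z + 4 * (c%:Z + 1)) - N).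
  have big : K <= 4 * (a i * B%:Z) by nia.
  have g1B : g1 B = 0.
    apply: jcount_sqr_eq0; rewrite -subr_ge0.
    set z := (X in 0 <= X); have -> : z = 4 * (a i * B%:Z) - K; last by lia.
    by rewrite /z /K -[k.+2]addn2 PoszD; ring.
  have g2B : g2 B = 0.
    apply: jcount_sqr_eq0; rewrite -subr_ge0.
    set z := (X in 0 <= X); have -> : z = 4 * (a i * B%:Z) - K; last by lia.
    by rewrite /z /K -[k.+2]addn2 PoszD; ring.
  have g10 : g1 0%N = eta (a i - k.+2%:Z).
    by rewrite /g1 /eta /K -[k.+2]addn2 PoszD; congr jcount; ring.
  have g20 : g2 0%N = eta (a i + k.+2%:Z).
    by rewrite /g2 /eta /K -[k.+2]addn2 PoszD; congr jcount; ring.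
  transitivity (\sum_(c < B) (g1 c + g2 c.+1)).
    apply: eq_bigr => c _; rewrite /g1 /g2 -[k.+2]addn2 -[c.+1]addn1 !PoszD.
    by congr (jcount _ _ + jcount _ _); ring.
  have := sum_shift B g1; have := sum_shift B g2.
  rewrite g1B g2B g10 g20 big_split /= => -> e1.
  have {}e1 : \sum_(c < B) g1 c = \sum_(c < B) g1 c.+1 + eta (a i - k.+2%:Z) by rewrite e1; ring.
  rewrite e1; set rhs := (X in _ = X + _).
  suff <- : \sum_(c < B) (g1 c.+1 + g2 c) = rhs.
    rewrite big_split/=.
    move: (\sum_(c < B) g1 c.+1) (\sum_(c < B) g2 c) => u v; ring.
  apply: eq_bigr => c _; rewrite /g1 /g2.
  have := jcount_step (a i - k.+1%:Z) (a i * (a i + 4 * (c.+1%:Z - 1) - 2 * k%:Z) - N).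
  have := jcount_step (a i + k.+1%:Z) (a i * (a i + 2 * k%:Z + 4 * (c%:Z + 1)) - N).
  have -> : a i - k.+1%:Z + 1 = a i - k%:Z by lia.
  have -> : a i - k.+1%:Z - 1 = a i - k.+2%:Z by lia.
  have -> : a i + k.+1%:Z - 1 = a i + k%:Z by lia.
  have -> : a i + k.+1%:Z + 1 = a i + k.+2%:Z by lia.
  have -> : c.+1%:Z - 1 = c by lia.
  move=> -> ->.
  (* Both uses of [jcount_step] bring in the same indicator, that of (k + 1)^2 + N = a (4 c + 2),
     with opposite signs. *)
  have eqC (p q p' q' : int) : p - q = p' - q' -> (p == q) = (p' == q').
    by move=> e; rewrite -[p == q]subr_eq0 e subr_eq0.
  rewrite (eqC ((a i - k.+1%:Z) ^+ 2) _ ((k%:Z + 1) ^+ 2 + N) (a i * (4 * c%:Z + 2))); last first.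
    by rewrite -[k.+1]addn1 PoszD; ring.
  rewrite (eqC ((a i + k.+1%:Z) ^+ 2) _ ((k%:Z + 1) ^+ 2 + N) (a i * (4 * c%:Z + 2))); last first.
    by rewrite -[k.+1]addn1 PoszD; ring.
  by ring.
rewrite (eq_bigr _ (fun i _ => inner i)) big_split /= sumrB.
rewrite sum_odd_fun ?subrr ?addr0 // => t.
  by rewrite /eta sqrrN jcountN.
move=> ht; rewrite /eta; case: (lerP K 0) => K0.
  by apply: jcount_sqr_eq0; lia.
apply: jcount_eq0; first by lia.
have -> : (t - 1) ^+ 2 = t ^+ 2 - 2 * t + 1 by ring.
lia.
Qed.

Lemma form_count_even (j : nat) (N : int) :
  (2 * j%:Z + 1) ^+ 2 + N <= 4 * B%:Z + 1 -> form_count (2 * j) N = form_count 0 N.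
Proof.
elim: j => [|j IHj] // h; rewrite mulnS add2n form_count_step.
  by apply: IHj; apply: le_trans h; rewrite lerD2r !expr2; nia.
by apply: le_trans h; rewrite lerD2r !expr2; nia.
Qed.

Lemma form_count_odd (j : nat) (N : int) :
  (2 * j%:Z + 2) ^+ 2 + N <= 4 * B%:Z + 1 -> form_count (2 * j).+1 N = form_count 1 N.
Proof.
elim: j => [|j IHj] // h; rewrite mulnS add2n form_count_step.
  by apply: IHj; apply: le_trans h; rewrite lerD2r !expr2; nia.
by apply: le_trans h; rewrite lerD2r !expr2; nia.
Qed.

Section Recurrence.
Variables (M K : nat).
Hypotheses (MB : (0 < M < B)%N) (BK : (B + M <= K)%N).

(** At N = 2 M - (k + 1)^2 the index k only translates the argument t of [phi] (see
    [form_count_phi]), so sums over k of one parity telescope. This [phi] is not the theta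
    series. *)
Let phi (X t : int) := jcount t ((t - 1) ^+ 2 + X).
Let off (i c : nat) : int := 2 * (a i * (2 * c%:Z + 1)) - 2 * M%:Z.

Lemma phi_reflect X t : phi X t + phi X (2 - t) = 2 * (X == 0)%:R.
Proof.
rewrite /phi; have := jcount_step (t - 1) ((t - 1) ^+ 2 + X).
rewrite subrK -subr_eq0 opprD addNKr oppr_eq0 => ->.
have -> : 2 - t = - (t - 1 - 1) by ring.
rewrite jcountN; have -> : (- (t - 1 - 1) - 1) ^+ 2 = (t - 1) ^+ 2 by ring.
by ring.
Qed.

(** The arguments n, n - 2, ..., 2 - n are permuted by t -> 2 - t, so [phi_reflect] evaluates twice
    the sum. *)
Lemma sum_phi X (n : nat) : \sum_(j < n) phi X (n%:Z - 2 * j%:Z) = n%:Z * (X == 0)%:R.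
Proof.
set S := LHS; suff : S + S = 2 * (n%:Z * (X == 0)%:R) by lia.
rewrite {2}/S (reindex_inj rev_ord_inj) /S -big_split /=.
rewrite (eq_bigr (fun=> 2 * (X == 0)%:R)) => [|j _].
  by rewrite sumr_const card_ord -mulr_natl natz; ring.
rewrite -(phi_reflect X (n%:Z - 2 * j%:Z)); congr (_ + phi _ _).
by have := ltn_ord j; lia.
Qed.

Lemma form_count_phi (k : nat) : form_count k (2 * M%:Z - (k%:Z + 1) ^+ 2) =
  \sum_(i < B) \sum_(c < B) (phi (off i c) (a i - k%:Z) - phi (off i c) (- a i - k%:Z)).
Proof.
apply: eq_bigr => i _; apply: eq_bigr => c _; rewrite /phi /off; congr (_ + _).
  by congr jcount; ring.
by rewrite -jcountN; congr jcount; ring.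
Qed.

Lemma phi_eq0 (i c : nat) t : (i < B)%N -> t <= 1 - M%:Z -> phi (off i c) t = 0.
Proof.
move=> iB ht; apply: jcount_sqr_eq0; rewrite /off /a.
have -> : (t - 1) ^+ 2 = t ^+ 2 - 2 * t + 1 by ring.
nia.
Qed.

Definition odd_div (i c : nat) : bool := (2 * i + 1) * (2 * c + 1) == M.

Lemma off_eq0 (i c : nat) : (off i c == 0) = odd_div i c.
Proof. by rewrite /off /a /odd_div; apply/eqP/eqP; lia. Qed.

(** [form_count_even] raises the index 0 to 2 j in the j-th term. For fixed a = 2 i + 1 the sum over
    j then telescopes to the first a values of phi (a - 2 j), which [sum_phi] evaluates; the tail
    vanishes by [phi_eq0]. *)
Lemma sum_form_count0 :
  \sum_(j < K) form_count 0 (2 * M%:Z - (2 * j%:Z + 1) ^+ 2) =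
  \sum_(i < B) \sum_(c < B) a i * (odd_div i c)%:R.
Proof.
transitivity (\sum_(j < K) form_count (2 * j) (2 * M%:Z - ((2 * j)%N%:Z + 1) ^+ 2)).
  apply: eq_bigr => j _; rewrite PoszM form_count_even //; lia.
under eq_bigr do rewrite form_count_phi.
rewrite exchange_big /=; apply: eq_bigr => i _.
rewrite exchange_big /=; apply: eq_bigr => c _.
pose g (j : nat) := phi (off i c) (a i - 2 * j%:Z).
have -> : a i * (odd_div i c)%:R = \sum_(j < 2 * i + 1) g j.
  by rewrite -off_eq0 -sum_phi; apply: eq_bigr => j _; congr phi; rewrite /a; lia.
have := @sum_shiftn K (2 * i + 1) g _.
rewrite sumrB => e.
rewrite -[RHS](subKr (\sum_(j < K) g j)) -e; last first.
  by move=> j Kj; apply: phi_eq0; rewrite /a; have := ltn_ord i; lia.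
by congr (_ - _); apply: eq_bigr => j _; congr phi; rewrite /a; lia.
Qed.

(** The telescoping is the same with index 2 j + 1, but the surviving arguments a - 1, a - 3, ..., 1
    - a are not symmetric under t -> 2 - t: the last one leaves a [jcount] term, compensated by the
    count at 2 M, which belongs to the square 0. *)
Lemma sum_form_count1 :
  form_count 1 (2 * M%:Z) + 2 * \sum_(j < K) form_count 1 (2 * M%:Z - (2 * j%:Z + 2) ^+ 2) =
  2 * \sum_(i < B) \sum_(c < B) a i * (odd_div i c)%:R.
Proof.
have -> : \sum_(j < K) form_count 1 (2 * M%:Z - (2 * j%:Z + 2) ^+ 2) =
  \sum_(i < B) \sum_(c < B) ((a i - 1) * (odd_div i c)%:R -
     jcount (a i - 1) (a i ^+ 2 + off i c)).
  transitivity (\sum_(j < K) form_count (2 * j).+1 (2 * M%:Z - ((2 * j).+1%:Z + 1) ^+ 2)).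
    apply: eq_bigr => j _; have -> : (2 * j).+1%:Z + 1 = 2 * j%:Z + 2 by lia.
    by rewrite form_count_odd //; lia.
  under eq_bigr do rewrite form_count_phi.
  rewrite exchange_big /=; apply: eq_bigr => i _.
  rewrite exchange_big /=; apply: eq_bigr => c _.
  pose g (j : nat) := phi (off i c) (a i - 1 - 2 * j%:Z).
  have -> : (a i - 1) * (odd_div i c)%:R - jcount (a i - 1) (a i ^+ 2 + off i c) =
      \sum_(j < (2 * i).+1) g j.
    rewrite big_ord_recr /=; congr (_ + _).
      rewrite -off_eq0; have -> : a i - 1 = (2 * i)%N by rewrite /a; lia.
      rewrite -sum_phi; apply: eq_bigr => j _; congr phi; rewrite /a; lia.
    rewrite /g /phi -jcountN; have -> : a i - 1 - 2 * (2 * i)%N%:Z = - (a i - 1) by rewrite /a; lia.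
    by congr jcount; ring.
  have := @sum_shiftn K (2 * i + 1) g _.
  rewrite sumrB => e.
  rewrite -[(2 * i).+1]addn1 -[RHS](subKr (\sum_(j < K) g j)) -e; last first.
    by move=> j Kj; apply: phi_eq0; rewrite /a; have := ltn_ord i; lia.
  by congr (_ - _); apply: eq_bigr => j _; congr phi; rewrite /a; lia.
pose F i (c : int) := jcount (a i - 1) (a i ^+ 2 + 2 * (a i * (2 * c + 1)) - 2 * M%:Z).
pose eta t := jcount t (t ^+ 2 - 1 - 2 * M%:Z).
(* The first summand of [form_count] is F at c - 1; the second, by [jcount_step] at a, is F at c + 1
   plus twice an indicator. Shifting c leaves a difference of [eta] that telescopes in i. *)
have -> : form_count 1 (2 * M%:Z) = \sum_(i < B) \sum_(c < B) (2 * F i c + 2 * (odd_div i c)%:R).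
  transitivity (\sum_(i < B) (\sum_(c < B) (2 * F i c + 2 * (odd_div i c)%:R)
      + (eta (2 * i%:Z) - eta (2 * i.+1%:Z)))).
    apply: eq_bigr => i _.
    pose D (c : nat) : int := (odd_div i c)%:R.
    pose g1 (c : nat) := F i (c%:Z - 1).
    pose g2 (c : nat) := F i c%:Z + 2 * D c.
    have a1 : 1 <= a i by rewrite /a; lia.
    have g1B : g1 B = 0.
      apply: jcount_sqr_eq0; rewrite -subr_ge0.
      set z := (X in 0 <= X).
      have -> : z = 4 * (a i * B%:Z) - 2 * M%:Z - 1 by rewrite /z; ring.
      nia.
    have g2B : g2 B = 0.
      rewrite /g2 /F /D /odd_div jcount_sqr_eq0; last first.
        rewrite -subr_ge0; set z := (X in 0 <= X).
        have -> : z = 4 * (a i * B%:Z) + 4 * a i - 2 * M%:Z - 1 by rewrite /z; ring.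
        nia.
      case: eqP => //; nia.
    have e1 := sum_shift B g1; have e2 := sum_shift B g2.
    rewrite g1B addr0 in e1; rewrite g2B addr0 in e2.
    transitivity (\sum_(c < B) (g1 c + g2 c.+1)).
      apply: eq_bigr => c _; congr (_ + _).
        by rewrite /g1 /F; congr jcount; ring.
      have := jcount_step (a i) (a i * (a i + 2 * 1 + 4 * (c%:Z + 1)) - 2 * M%:Z).
      move=> ->; rewrite /g2 /F /D; congr (_ + 2 * _).
        by congr jcount; rewrite -[c.+1]addn1 PoszD; ring.
      congr (_%:R); rewrite /odd_div /a; apply/eqP/eqP; nia.
    rewrite big_split /= e2.
    have -> : \sum_(c < B) g1 c = \sum_(c < B) F i c + g1 0%N.
      have -> : \sum_(c < B) F i c = \sum_(c < B) g1 c.+1.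
        by apply: eq_bigr => c _; rewrite /g1; congr F; lia.
      by rewrite e1 subrK.
    have -> : g1 0%N = eta (2 * i%:Z).
      by rewrite /g1 /F /eta /a; congr jcount; ring.
    have -> : g2 0%N = eta (2 * i.+1%:Z).
      rewrite /eta; have -> : 2 * i.+1%:Z = a i + 1 by rewrite /a; lia.
      rewrite jcount_step /g2 /F /D; congr (_ + 2 * _).
        by congr jcount; ring.
      by congr (_%:R); rewrite /odd_div /a; apply/eqP/eqP; nia.
    rewrite /g2 !big_split /= -!mulr_sumr.
    by move: (\sum_(c < B) _) (\sum_(c < B) _) => u v; ring.
  rewrite big_split /= -[RHS]addr0; congr (_ + _).
  rewrite sumrB (sum_shift B (fun i => eta (2 * i%:Z))).
  have -> : eta (2 * B%:Z) = 0.
    apply: jcount_eq0; first by lia.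
    have -> : (2 * B%:Z - 1) ^+ 2 = (2 * B%:Z) ^+ 2 - 4 * B%:Z + 1 by ring.
    lia.
  have -> : eta (2 * 0%N%:Z) = 0 by [].
  by ring.
rewrite !mulr_sumr -big_split /=; apply: eq_bigr => i _.
rewrite !mulr_sumr -big_split /=; apply: eq_bigr => c _.
have -> : F i c = jcount (a i - 1) (a i ^+ 2 + off i c).
  by rewrite /F /off addrA.
by ring.
Qed.

End Recurrence.
End ClassNumber.

(** * Vanishing and positivity of the form counts *)

Section WValues.
Local Open Scope ring_scope.

Lemma form_count0_eq0 B N : N <= 0 -> form_count B 0 N = 0.
Proof.
move=> N0; apply: big1 => i _; apply: big1 => c _.
by rewrite !jcount_sqr_eq0 ?addr0 //; nia.
Qed.

Lemma form_count1_eq0 B N : N <= -1 -> form_count B 1 N = 0.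
Proof.
move=> N0; apply: big1 => i _; apply: big1 => c _.
by rewrite !jcount_sqr_eq0 ?addr0 //; nia.
Qed.

Lemma ge_sum_term (B i c : nat) (f : nat -> nat -> int) :
  (forall i c, 0 <= f i c) -> (i < B)%N -> (c < B)%N ->
  f i c <= \sum_(i < B) \sum_(c < B) f i c.
Proof.
move=> f0 iB cB; rewrite (bigD1 (Ordinal iB)) //= (bigD1 (Ordinal cB)) //= -addrA.
rewrite lerDl addr_ge0 ?sumr_ge0 // => i' _.
by rewrite sumr_ge0.
Qed.

Lemma form_count_ge_term (B i c k : nat) N : (i < B)%N -> (c < B)%N -> (k <= 1)%N ->
  (jcount (2 * i%:Z + 1 - k%:Z) ((2 * i%:Z + 1) * ((2 * i%:Z + 1) + 4 * c%:Z - 2 * k%:Z) - N) +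
   jcount (2 * i%:Z + 1 + k%:Z)
     ((2 * i%:Z + 1) * ((2 * i%:Z + 1) + 2 * k%:Z + 4 * (c%:Z + 1)) - N)) <= form_count B k N.
Proof.
move=> iB cB k1.
pose f (i c : nat) :=
   jcount (2 * i%:Z + 1 - k%:Z) ((2 * i%:Z + 1) * ((2 * i%:Z + 1) + 4 * c%:Z - 2 * k%:Z) - N) +
   jcount (2 * i%:Z + 1 + k%:Z) ((2 * i%:Z + 1) * ((2 * i%:Z + 1) + 2 * k%:Z + 4 * (c%:Z + 1)) - N).
apply: (@ge_sum_term B i c f) => // i' c'.
by apply: addr_ge0; apply: jcount_ge0; lia.
Qed.

Lemma form_count0_gt0 B m : (m < B)%N -> 0 < form_count B 0 (4 * m + 1)%N%:Z.
Proof.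
move=> mB; have B0 : (0 < B)%N by lia.
apply: lt_le_trans (form_count_ge_term _ B0 mB _) => //.
(* The form with a = 1, J = 0 and C = 4 m + 1. *)
have -> : (2 * 0%N%:Z + 1) * (2 * 0%N%:Z + 1 + 4 * m%:Z - 2 * 0%N%:Z) - (4 * m + 1)%N%:Z = 0 by lia.
by rewrite ltr_pwDl // jcount_ge0.
Qed.

Lemma form_count1_gt0 B m : (m < B)%N -> (0 < m)%N -> 0 < form_count B 1 (4 * m + 2)%N%:Z.
Proof.
move=> mB m0; have B0 : (0 < B)%N by lia.
have mB' : (m.-1 < B)%N by lia.
apply: lt_le_trans (form_count_ge_term _ B0 mB' _) => //.
(* The index c = m - 1, available for m > 0, gives a = 1, C = 4 m + 3 and the boundary values J = 1
   and J = -1. *)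
have -> : (2 * 0%N%:Z + 1) * (2 * 0%N%:Z + 1 + 2 * 1%N%:Z + 4 * (m.-1%:Z + 1)) - (4 * m + 2)%N%:Z = 1 by lia.
by rewrite ltr_wpDl // jcount_ge0.
Qed.
End WValues.

(** * Theta series and three squares *)

Section EqMod.
Local Open Scope ring_scope.
Implicit Types (d : int) (n : nat) (p q r s : {poly int}).

(* Congruence modulo the ideal generated by [d] and ['X^n]; [d = 0] is allowed. *)
Definition eqpm d n p q := forall i, (i < n)%N -> (d %| p`_i - q`_i)%Z.

Lemma eqpm_refl d n p : eqpm d n p p.
Proof. by move=> i _; rewrite subrr dvdz0. Qed.

Lemma eqpm_sym d n p q : eqpm d n p q -> eqpm d n q p.
Proof. by move=> h i ni; rewrite -opprB rpredN h. Qed.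

Lemma eqpm_trans d n p q r : eqpm d n p q -> eqpm d n q r -> eqpm d n p r.
Proof. by move=> h1 h2 i ni; rewrite -(subrK q`_i p`_i) -addrA rpredD ?h1 ?h2. Qed.

Lemma eqpmD d n p q r s : eqpm d n p q -> eqpm d n r s -> eqpm d n (p + r) (q + s).
Proof. by move=> h1 h2 i ni; rewrite !coefD opprD addrACA rpredD ?h1 ?h2. Qed.

Lemma eqpmN d n p q : eqpm d n p q -> eqpm d n (- p) (- q).
Proof. by move=> h i ni; rewrite !coefN -opprD rpredN h. Qed.

Lemma eqpmMr d n r p q : eqpm d n p q -> eqpm d n (p * r) (q * r).
Proof.
move=> h i ni; rewrite -coefB -mulrBl coefM rpred_sum // => j _.
by rewrite dvdz_mulr // coefB h //; apply: leq_ltn_trans ni; rewrite -ltnS.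
Qed.

Lemma eqpmMl d n r p q : eqpm d n p q -> eqpm d n (r * p) (r * q).
Proof. by rewrite ![r * _]mulrC; apply: eqpmMr. Qed.

Lemma eqpmM d n p q r s : eqpm d n p q -> eqpm d n r s -> eqpm d n (p * r) (q * s).
Proof. by move=> h1 h2; apply: eqpm_trans (eqpmMr r h1) (eqpmMl q h2). Qed.

Lemma eqpmX d n k p q : eqpm d n p q -> eqpm d n (p ^+ k) (q ^+ k).
Proof.
move=> h; elim: k => [|k IH]; first by rewrite !expr0; apply: eqpm_refl.
by rewrite !exprS; apply: eqpmM.
Qed.

Lemma eqpm_dvd d d' n p q : (d %| d')%Z -> eqpm d' n p q -> eqpm d n p q.
Proof. by move=> dd h i ni; apply: dvdz_trans dd (h i ni). Qed.

Lemma eqpm_coef n p q i : eqpm 0 n p q -> (i < n)%N -> p`_i = q`_i.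
Proof. by move=> h ni; apply/eqP; rewrite -subr_eq0 -dvd0z h. Qed.

Lemma eqpm_cancel d n r p q : r`_0 = 1 -> eqpm d n (r * p) (r * q) -> eqpm d n p q.
Proof.
move=> r0 h i; elim/ltn_ind: i => i IH ni.
have := h i ni; rewrite -coefB -mulrBr coefM big_ord_recl /= r0 mul1r subn0 coefB.
rewrite rpredDr // rpred_sum // => j _.
rewrite dvdz_mull // coefB IH //; rewrite /bump /=; have := ltn_ord j; lia.
Qed.

Lemma eqpm_compX2 d n p q : eqpm d n p q -> eqpm d n.*2 (p \Po 'X^2) (q \Po 'X^2).
Proof.
move=> h i ni; rewrite !coef_comp_poly_Xn //; case: ifP => i2; last by rewrite subrr dvdz0.
apply: h; lia.
Qed.

Lemma eqpm_add d n (p q r : {poly int}) : p = q + d%:P * r -> eqpm d n p q.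
Proof. by move=> -> i _; rewrite coefD addrAC subrr add0r coefCM dvdz_mulr. Qed.

(** In p^2 - q^2 = (p - q) (p + q) the second factor is (p - q) + 2 q, which is even because d
    is. *)
Lemma eqpm_sqr d n (p q : {poly int}) :
  (2 %| d)%Z -> eqpm d n p q -> eqpm (2 * d) n (p ^+ 2) (q ^+ 2).
Proof.
move=> d2 h i ni; rewrite -coefB subr_sqr coefM rpred_sum // => j _.
have jn : (j < n)%N by apply: leq_trans (ltn_ord j) _.
rewrite [2 * d]mulrC dvdz_mul // ?coefB ?h // coefD.
have ijn : (i - j < n)%N by apply: leq_ltn_trans ni; rewrite leq_subr.
have -> : p`_(i - j) + q`_(i - j) = (p`_(i - j) - q`_(i - j)) + 2 * q`_(i - j) by ring.
by rewrite rpredD ?dvdz_mulr //; apply: dvdz_trans d2 (h _ ijn).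
Qed.

Lemma eqpm_leq d m n p q : (m <= n)%N -> eqpm d n p q -> eqpm d m p q.
Proof. by move=> mn h i im; apply: h; apply: leq_trans im mn. Qed.

Lemma eqpm16 n r p q : eqpm 2 n p q -> eqpm 32 n (16 * r * p) (16 * r * q).
Proof.
move=> h; rewrite -!mulrA -[16 : {poly int}]/(16%:R) -polyC_natr => i ni.
have := eqpmMl r h ni; rewrite !coefCM -mulrBr => h'.
by rewrite -(@dvdz_mul2l 16) // in h'.
Qed.

End EqMod.

(** * Theta series, divisor sums and three squares *)

Section Theta.
Local Open Scope ring_scope.

Lemma sum_iota (V : nmodType) (L : nat) (G : nat -> V) :
  \sum_(i <- iota 0 L) G i = \sum_(i < L) G i.
Proof. by rewrite -(big_mkord xpredT G) /index_iota subn0. Qed.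

(* For u, v odd, the pair ((u + v) / 2, (u - v) / 2) has an odd and an even entry, in this
   order, once the sign of v is chosen so that u = v modulo 4. *)
Lemma sum_two_odd_squares (L N : nat) : (2 * N < L)%N ->
  \sum_(p <- [seq (i, j) | i <- iota 0 L, j <- iota 0 L])
     ((2 * p.1 + 1) ^ 2 + (2 * p.2 + 1) ^ 2 == 2 * N)%N%:R =
  \sum_(p <- [seq (i, y) | i <- iota 0 L, y <- zrange L])
     ((2 * p.1 + 1) ^ 2 + 4 * absz p.2 ^ 2 == N)%N%:R :> int.
Proof.
move=> NL.
under eq_bigr do rewrite mulrb; under [RHS]eq_bigr do rewrite mulrb.
rewrite -!big_mkcond.
pose f (p : nat * nat) : nat * int :=
  let: (i, j) := p in
  if odd (i + j) then
    if (j < i)%N then ((i - j).-1./2, (i + j).+1./2%:Z)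
    else ((j - i).-1./2, - (i + j).+1./2%:Z)
  else ((i + j)./2, if (j <= i)%N then (i - j)./2%:Z else - (j - i)./2%:Z).
pose g (p : nat * int) : nat * nat :=
  let: (i, y) := p in
  if (absz y <= i)%N then (absz (i%:Z + y)%R, absz (i%:Z - y)%R)
  else if 0 < y then (absz (y + i%:Z)%R, absz (y - i%:Z - 1)%R)
  else (absz (- y - i%:Z - 1)%R, absz (- y + i%:Z)%R).
have fS (i j : nat) : let: (i', y) := f (i, j) in
   if odd (i + j) then
     (i%:Z = i'%:Z + y /\ j%:Z = y - i'%:Z - 1) \/
     (i%:Z = - y - i'%:Z - 1 /\ j%:Z = - y + i'%:Z)
   else (i%:Z = i'%:Z + y /\ j%:Z = i'%:Z - y).
  rewrite /f; case: ifP => h; last by case: ifP => h2; lia.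
  by case: ifP => h2; [left | right]; lia.
have fE i j : let: (i', y) := f (i, j) in
  ((2 * i' + 1) ^ 2 + 4 * absz y ^ 2 == N)%N = ((2 * i + 1) ^ 2 + (2 * j + 1) ^ 2 == 2 * N)%N.
  have := fS i j; case: (f (i, j)) => i' y h.
  have : ((2 * i + 1) ^ 2 + (2 * j + 1) ^ 2)%N = (2 * ((2 * i' + 1) ^ 2 + 4 * absz y ^ 2))%N.
    suff : (2 * i%:Z + 1) ^+ 2 + (2 * j%:Z + 1) ^+ 2 = 2 * ((2 * i'%:Z + 1) ^+ 2 + 4 * y ^+ 2) by lia.
    by move: h; case: ifP => _; [case|]; move=> [-> ->]; ring.
  by lia.
have gK i y : f (g (i, y)) = (i, y).
  rewrite /g; case: ifP => h1; last (case: ifP => h2); rewrite /f.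
  - have -> : odd (absz (i%:Z + y)%R + absz (i%:Z - y)%R) = false by lia.
    by congr (_, _); [lia | case: ifP => h; lia].
  - have -> : odd (absz (y + i%:Z)%R + absz (y - i%:Z - 1)%R) by lia.
    by case: ifP => h; congr (_, _); lia.
  - have -> : odd (absz (- y - i%:Z - 1)%R + absz (- y + i%:Z)%R) by lia.
    by case: ifP => h; congr (_, _); lia.
have fK i j : g (f (i, j)) = (i, j).
  have := fS i j; case: (f (i, j)) => i' y; rewrite /g; case: ifP => h1.
    case=> -[e1 e2].
      by case: ifP => h2; [|case: ifP => h3]; congr (_, _); lia.
    by case: ifP => h2; [|case: ifP => h3]; congr (_, _); lia.
  by move=> [e1 e2]; case: ifP => h2; [|case: ifP => h3]; congr (_, _); lia.
have bound1 (i n : nat) : ((2 * i + 1) ^ 2 <= n -> i <= n)%N by move=> ?; nia.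
have bound2 (i n : nat) : (4 * i ^ 2 <= n -> i <= n)%N by move=> ?; nia.
apply: (big_seq_bij (f := f) (g := g)).
- by apply: uniq_pairs; rewrite ?iota_uniq.
- by apply: uniq_pairs; rewrite ?iota_uniq ?uniq_zrange.
- move=> [i j] _ h; have {}h : ((2 * i + 1) ^ 2 + (2 * j + 1) ^ 2 == 2 * N)%N := h.
  have := fE i j; have := fK i j; case: (f (i, j)) => i' y gK'; rewrite h => e; split=> //.
  rewrite mem_pairs mem_iota mem_zrange [(_, _).1]/= [(_, _).2]/=.
  have := bound1 i' N; have := bound2 (absz y) N; lia.
move=> [i y] _ h; have {}h : ((2 * i + 1) ^ 2 + 4 * absz y ^ 2 == N)%N := h.
have := gK i y; case: (g (i, y)) => i' j e.
have := fE i' j; rewrite e h => /esym h'; split=> //.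
rewrite mem_pairs !mem_iota [(_, _).1]/= [(_, _).2]/=.
have := bound1 i' (2 * N)%N; have := bound1 j (2 * N)%N; lia.
Qed.

Lemma coef_sumX (I : Type) (s : seq I) (f : I -> nat) (p : {poly int}) R :
  ((\sum_(i <- s) 'X^(f i)) * p)`_R = \sum_(i <- s) (f i <= R)%N%:R * p`_(R - f i).
Proof.
rewrite mulr_suml coef_sum; apply: eq_bigr => i _.
by rewrite coefXnM ltnNge; case: leqP => _; rewrite ?mul1r ?mul0r.
Qed.

Lemma coef_mul_sumX (I J : Type) (s : seq I) (s' : seq J) (f : I -> nat) (g : J -> nat) R :
  ((\sum_(i <- s) 'X^(f i)) * (\sum_(j <- s') 'X^(g j)) : {poly int})`_R =
  \sum_(p <- [seq (i, j) | i <- s, j <- s']) (f p.1 + g p.2 == R)%N%:R.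
Proof.
rewrite big_distrlr /= big_allpairs coef_sum; apply: eq_bigr => i _.
by rewrite coef_sum; apply: eq_bigr => j _; rewrite -exprD coefXn eq_sym.
Qed.

Definition odd_theta (L : nat) : {poly int} := \sum_(i <- iota 0 L) 'X^((2 * i + 1) ^ 2).
Definition even_theta (L : nat) : {poly int} := \sum_(y <- zrange L) 'X^(4 * absz y ^ 2).
(** For m > 0 and M odd, small compared with L, the coefficient at m M is sigma(M): each
    factorization of M into odd factors contributes the first one. *)
Definition sigma_poly (m L : nat) : {poly int} :=
  \sum_(i < L) \sum_(c < L) (2 * i%:Z + 1) *: 'X^(m * ((2 * i + 1) * (2 * c + 1))).

Lemma odd_theta_sqr L : eqpm 0 L (odd_theta L ^+ 2) ((odd_theta L * even_theta L) \Po 'X^2).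
Proof.
move=> m mL; rewrite dvd0z subr_eq0 coef_comp_poly_Xn // expr2 !coef_mul_sumX.
case: ifP => [/dvdnP[N hN]|m2].
  rewrite hN mulnK // [(N * 2)%N]mulnC sum_two_odd_squares //; lia.
apply/eqP; apply: big1 => -[i j] _ /=; case: eqP => // e.
by exfalso; move: m2; rewrite -e; lia.
Qed.

Lemma coef_sigma_poly m L R : (sigma_poly m L)`_R = \sum_(i < L) \sum_(c < L)
  (2 * i%:Z + 1) * (m * ((2 * i + 1) * (2 * c + 1)) == R)%N%:R.
Proof.
rewrite coef_sum; apply: eq_bigr => i _; rewrite coef_sum; apply: eq_bigr => c _.
by rewrite coefZ coefXn eq_sym.
Qed.

(** With psi = [odd_theta L], this is the coefficient of X^R in psi X p' - 4 X psi' p, which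
    vanishes at p = psi^4: for n = R - s, the factor R - 5 s is n - 4 s. *)
Definition weighted_conv L (p : {poly int}) (R : nat) : int := \sum_(j < L)
  ((2 * j + 1) ^ 2 <= R)%N%:R * ((R%:Z - 5 * ((2 * j + 1) ^ 2)%N%:Z) * p`_(R - (2 * j + 1) ^ 2)).

(* Euler's identity X (odd_theta^5)' = 5 X odd_theta' odd_theta^4. *)
Lemma weighted_conv_theta4 L R : weighted_conv L (odd_theta L ^+ 4) R = 0.
Proof.
have e1 : ('X * (odd_theta L ^+ 5)^`())`_R = R%:Z * (odd_theta L ^+ 5)`_R.
  case: R => [|R]; first by rewrite coefXM mul0r.
  by rewrite coefXM coef_deriv /= -mulr_natl natz.
have e2 : 'X * (odd_theta L ^+ 5)^`() =
    5 * (\sum_(i <- iota 0 L) ((2 * i + 1) ^ 2)%N%:Z *: 'X^((2 * i + 1) ^ 2)) *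
    odd_theta L ^+ 4.
  rewrite deriv_exp -mulr_natl.
  have -> : \sum_(i <- iota 0 L) ((2 * i + 1) ^ 2)%N%:Z *: 'X^((2 * i + 1) ^ 2) = 'X * (odd_theta L)^`().
    rewrite /odd_theta raddf_sum mulr_sumr; apply: eq_bigr => i _.
    rewrite -[RHS]/('X * ('X^((2 * i + 1) ^ 2))^`()) derivXn mulrnAr -exprS prednK; last by lia.
    by rewrite -scaler_nat natz.
  by rewrite /=; ring.
move: e1; rewrite e2 [odd_theta L ^+ 5]exprS /weighted_conv; move: (odd_theta L ^+ 4) => p.
rewrite -mulrA coef_sumX -[5%R]/(5%:R) -polyC_natr coefCM.
rewrite mulr_suml coef_sum !mulr_sumr !sum_iota => e1.
rewrite -[RHS](subrr (\sum_(j < L) R%:Z * (((2 * j + 1) ^ 2 <= R)%N%:R * p`_(R - (2 * j + 1) ^ 2)))).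
rewrite -{2}e1 -sumrB; apply: eq_bigr => j _.
rewrite -scalerAl coefZ coefXnM ltnNge; case: leqP => _ /=; rewrite ?mul0r ?mulr0 ?subr0 //.
by ring.
Qed.

(** At R = x^2 + 4 d e the factor R - 5 x^2 is 4 (d e - x^2), so [odd_weighted_sum] applies. *)
Lemma weighted_conv_sigma L R : (R <= L)%N -> weighted_conv L (sigma_poly 4 L) R = 0.
Proof.
move=> RL; rewrite -(mulr0 4) -(odd_weighted_sum RL) /weighted_conv mulr_sumr.
apply: eq_bigr => j _; rewrite coef_sigma_poly !mulr_sumr; apply: eq_bigr => i _.
rewrite !mulr_sumr; apply: eq_bigr => c _.
set x := ((2 * j + 1) ^ 2)%N; set a := (4 * ((2 * i + 1) * (2 * c + 1)))%N.
case: (leqP x R) => xR; last first.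
  by rewrite mul0r; case: eqP => [e|]; rewrite ?mul0r ?mulr0 //; lia.
have -> : (a == R - x)%N = (x + a == R)%N by lia.
case: eqP => [<-|_]; last by rewrite mul0r !mulr0.
have -> : (x + a)%N%:Z - 5 * x%:Z = a%:Z - 4 * x%:Z by lia.
have -> : x%:Z = (2 * j%:Z + 1) ^+ 2 by rewrite /x; lia.
have -> : a%:Z = 4 * ((2 * i%:Z + 1) * (2 * c%:Z + 1)) by rewrite /a; lia.
by rewrite mulr1 !mul1r; ring.
Qed.

(* In the recursion for R = N + 1 the coefficient of index N is multiplied by N - 4. *)
Lemma odd_theta_pow4 L : eqpm 0 L (odd_theta L ^+ 4) (sigma_poly 4 L).
Proof.
suff H N : (N < L)%N -> (odd_theta L ^+ 4)`_N = (sigma_poly 4 L)`_N.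
  by move=> N NL; rewrite H // subrr.
elim/ltn_ind: N => N IH NL.
have L0 : (0 < L)%N by lia.
(* For N = 4 both sides are computed: [odd_theta L] agrees with X below degree 9, and in
   [sigma_poly] only i = c = 0 contributes. *)
case: (eqVneq N 4%N) => [N4|N4].
  have -> : (odd_theta L ^+ 4)`_N = 1.
    have : eqpm 0 9 (odd_theta L) 'X.
      move=> i i9; rewrite dvd0z subr_eq0; apply/eqP.
      rewrite -[odd_theta L]mulr1 coef_sumX sum_iota.
      rewrite (bigD1 (Ordinal L0)) //= coefX big1 => [|j j0].
        by rewrite addr0 coef1; lia.
      rewrite coef1; have : (0 < j)%N by rewrite lt0n; apply: contra j0 => /eqP j0; apply/eqP/val_inj.
      by nia.
    move=> /(@eqpmX _ _ 4) /eqpm_coef ->; last by lia.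
    by rewrite N4 coefXn.
  rewrite coef_sigma_poly (bigD1 (Ordinal L0)) //= (bigD1 (Ordinal L0)) //= !big1 ?N4 ?addr0 //.
    move=> i i0; apply: big1 => c _.
    have : (0 < i)%N by rewrite lt0n; apply: contra i0 => /eqP i0; apply/eqP/val_inj.
    by case: eqP => [|_]; rewrite ?mulr0 //; nia.
  move=> c c0.
  have : (0 < c)%N by rewrite lt0n; apply: contra c0 => /eqP c0; apply/eqP/val_inj.
  by case: eqP => [|_]; rewrite ?mulr0 //; nia.
have : weighted_conv L (odd_theta L ^+ 4) N.+1 = weighted_conv L (sigma_poly 4 L) N.+1.
  by rewrite weighted_conv_theta4 weighted_conv_sigma.
rewrite /weighted_conv.
rewrite (bigD1 (Ordinal L0)) //= [in RHS](bigD1 (Ordinal L0)) //=.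
set A := (\sum_(j < L | _) _); set A' := (\sum_(j < L | _) _).
have -> : A = A'.
  apply: eq_bigr => j j0; case: leqP => hj; rewrite ?mul0r // IH //; last by lia.
  have : (0 < j)%N by rewrite lt0n; apply: contra j0 => /eqP j0; apply/eqP/val_inj.
  by nia.
move=> /addIr; rewrite !mul1r subn1 /=; apply: mulfI.
by apply/eqP; lia.
Qed.

Lemma odd_even_theta_sqr L n : (2 * n <= L)%N ->
  eqpm 0 n ((odd_theta L * even_theta L) ^+ 2) (sigma_poly 2 L).
Proof.
move=> nL.
have H : eqpm 0 L (((odd_theta L * even_theta L) ^+ 2) \Po 'X^2) (sigma_poly 4 L).
  rewrite rmorphXn; apply: (eqpm_trans (q := odd_theta L ^+ 4) _ (@odd_theta_pow4 L)); apply: eqpm_sym.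
  rewrite -[4%N]/(2 * 2)%N exprM; exact: (eqpmX 2 (@odd_theta_sqr L)).
move=> N Nn; have := H (2 * N)%N; rewrite coef_comp_poly_Xn // dvdn_mulr // mulKn //.
have -> : (sigma_poly 4 L)`_(2 * N) = (sigma_poly 2 L)`_N; last by apply; lia.
rewrite !coef_sigma_poly; apply: eq_bigr => i _; apply: eq_bigr => c _; congr (_ * (nat_of_bool _)%:R).
by apply/eqP/eqP; lia.
Qed.

Lemma coef_sigma_odd_div B L M : (M <= B <= L)%N -> (sigma_poly 2 L)`_(2 * M) =
  \sum_(i < B) \sum_(c < B) (2 * i%:Z + 1) * (odd_div M i c)%:R.
Proof.
move=> /andP[MB BL]; rewrite coef_sigma_poly.
pose F (i c : nat) : int := (2 * i%:Z + 1) * (odd_div M i c)%:R.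
have F0 i c : (B <= i)%N || (B <= c)%N -> F i c = 0.
  by move=> h; rewrite /F /odd_div; case: eqP => [|_]; rewrite ?mulr0 //; nia.
rewrite (big_ord_widen L (fun i => \sum_(c < B) F i c) BL) [RHS]big_mkcond.
apply: eq_bigr => i _; rewrite (big_ord_widen L (fun c => F i c) BL) [in RHS]big_mkcond /=.
transitivity (\sum_(c < L) F i c).
  by apply: eq_bigr => c _; congr (_ * (nat_of_bool _)%:R); rewrite /odd_div; apply/eqP/eqP; lia.
case: ifPn => iB; last by apply: big1 => c _; apply: F0; rewrite leqNgt iB.
by apply: eq_bigr => c _; case: ifPn => cB //; apply: F0; rewrite orbC leqNgt cB.
Qed.

(** Multiplied by psi, both sides give the same divisor sum at N + 1 = 2 M, by [odd_even_theta_sqr]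
    and [sum_form_count0]. The square 1 isolates the index N; the other squares lead to smaller
    indices, again 1 modulo 4. *)
Lemma coef_odd_even_even B L N : (N <= B)%N -> (4 * B + 4 <= L)%N -> (N %% 4 = 1)%N ->
  (odd_theta L * even_theta L ^+ 2)`_N = form_count B.+1 0 N.
Proof.
move=> NB BL; elim/ltn_ind: N NB => N IH NB N4.
have [m hm] : exists m, N = (4 * m + 1)%N by exists (N %/ 4)%N; lia.
pose M := (2 * m + 1)%N.
have hM : N.+1 = (2 * M)%N by rewrite /M; lia.
have L0 : (0 < L)%N by lia.
have MB : (0 < M < B.+1)%N by lia.
have LK : (B.+1 + M <= L)%N by lia.
have : ((odd_theta L * even_theta L) ^+ 2)`_N.+1 = (sigma_poly 2 L)`_N.+1.
  by apply: eqpm_coef (odd_even_theta_sqr (n := N.+2) _) _; lia.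
rewrite {2}hM (@coef_sigma_odd_div B.+1); last by lia.
rewrite -(sum_form_count0 MB LK).
have -> : (odd_theta L * even_theta L) ^+ 2 = odd_theta L * (odd_theta L * even_theta L ^+ 2) by ring.
rewrite {1}/odd_theta coef_sumX sum_iota.
rewrite (bigD1 (Ordinal L0)) //= [in RHS](bigD1 (Ordinal L0)) //=.
set A := (\sum_(j < L | _) _); set A' := (\sum_(j < L | _) _).
have -> : A = A'.
  apply: eq_bigr => j j0.
  have {}j0 : (0 < j)%N by rewrite lt0n; apply: contra j0 => /eqP j0; apply/eqP/val_inj.
  have j2 : (2 * j%:Z + 1) ^+ 2 = ((2 * j + 1) ^ 2)%N%:Z by lia.
  have [z hz] : exists z, ((2 * j + 1) ^ 2 = 4 * z + 1)%N by exists (j * j + j)%N; lia.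
  rewrite j2; case: leqP => hj; last by rewrite mul0r form_count0_eq0 //; lia.
  rewrite mul1r IH; [congr form_count; lia | nia | lia | lia].
move=> /addIr; rewrite mul1r subn1 /= => ->; congr form_count; lia.
Qed.

(** Now the factor is phi, at N = 2 M, and the square 0 isolates the index N. The signs of y double
    the other squares as in [sum_form_count1], whose right-hand side is twice the divisor sum; hence
    the factor 2. *)
Lemma coef_odd_odd_even B L N : (N <= B)%N -> (4 * B + 4 <= L)%N -> (N %% 4 = 2)%N ->
  2 * (odd_theta L ^+ 2 * even_theta L)`_N = form_count B.+1 1 N.
Proof.
move=> NB BL; elim/ltn_ind: N NB => N IH NB N4.
have [m hm] : exists m, N = (4 * m + 2)%N by exists (N %/ 4)%N; lia.
pose M := (2 * m + 1)%N.
have hM : N = (2 * M)%N by rewrite /M; lia.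
have MB : (0 < M < B.+1)%N by lia.
have LK : (B.+1 + M <= L)%N by lia.
have : ((odd_theta L * even_theta L) ^+ 2)`_N = (sigma_poly 2 L)`_N.
  by apply: eqpm_coef (odd_even_theta_sqr (n := N.+1) _) _; lia.
rewrite {2}hM (@coef_sigma_odd_div B.+1); last by lia.
move=> e; have := sum_form_count1 MB LK; rewrite -e {e}.
have -> : (odd_theta L * even_theta L) ^+ 2 = even_theta L * (odd_theta L ^+ 2 * even_theta L) by ring.
rewrite {2}/even_theta coef_sumX.
rewrite (sum_zrange L (fun y => (4 * y ^ 2 <= N)%N%:R *
  (odd_theta L ^+ 2 * even_theta L)`_(N - 4 * y ^ 2))).
rewrite mul1r subn0 mulr2n.
set A := (\sum_(j < L) _); set A' := (\sum_(j < L) _).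
have -> : A = 2 * A'.
  rewrite mulr_sumr; apply: eq_bigr => j _.
  have j2 : (2 * j%:Z + 2) ^+ 2 = (4 * j.+1 ^ 2)%N%:Z by lia.
  rewrite j2; case: (leqP (4 * j.+1 ^ 2) N) => hj; last first.
    by rewrite mul0r mulr0 form_count1_eq0 //; lia.
  rewrite mul1r IH; [congr form_count; lia | nia | lia | lia].
have -> : form_count B.+1 1 N = form_count B.+1 1 (2 * M%:Z) by congr form_count; lia.
by move: (form_count _ _ _) A' (_`_N) => w s u; lia.
Qed.

Lemma coef_sumX_neq0 (I : eqType) (s : seq I) (f : I -> nat) (p : {poly int}) R :
  ((\sum_(i <- s) 'X^(f i)) * p)`_R != 0 -> exists2 i, (f i <= R)%N & p`_(R - f i) != 0.
Proof.
rewrite coef_sumX => h.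
case: (boolP (has (fun i => (f i <= R)%N && (p`_(R - f i) != 0)) s)) => [/hasP[i _ /andP[h1 h2]]|].
  by exists i.
move=> /hasPn h'; case/eqP: h; rewrite big_seq big1 // => i /h'.
by case: leqP => _ /=; rewrite ?mul0r // negbK mul1r => /eqP.
Qed.

Lemma odd_sqr_posz (i : nat) : ((2 * i + 1) ^ 2)%N%:Z = (2 * i%:Z + 1) ^+ 2.
Proof. by lia. Qed.

Lemma even_sqr_absz (y : int) : (4 * absz y ^ 2)%N%:Z = (2 * y) ^+ 2.
Proof.
have hy : (absz y)%:Z ^+ 2 = y ^+ 2 by rewrite abszE real_normK ?num_real.
by rewrite exprMn -hy; lia.
Qed.

Lemma sub3_eq0 (N a b c : nat) :
  (a <= N)%N -> (b <= N - a)%N -> (c <= N - a - b)%N -> (N - a - b - c = 0)%N ->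
  N%:Z = a%:Z + b%:Z + c%:Z.
Proof. lia. Qed.

Lemma three_squares_1mod4 N : (N %% 4 = 1)%N -> sum_of_three_squares N.
Proof.
move=> N4; have := @coef_odd_even_even N _ N (leqnn N) (leqnn _) N4.
have [m hm] : exists m, N = (4 * m + 1)%N by exists (N %/ 4)%N; lia.
move=> e; have : (odd_theta (4 * N + 4) * even_theta (4 * N + 4) ^+ 2)`_N != 0.
  by rewrite e {2}hm; apply: lt0r_neq0; apply: form_count0_gt0; lia.
move=> /coef_sumX_neq0[i hi] /coef_sumX_neq0[y hy].
rewrite -[even_theta _]mulr1 => /coef_sumX_neq0[z hz].
rewrite coef1 pnatr_eq0 eqb0 negbK => /eqP h.
exists (2 * i%:Z + 1), (2 * y), (2 * z).
by rewrite -odd_sqr_posz -!even_sqr_absz; apply: sub3_eq0.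
Qed.

Lemma three_squares_2mod4 N : (N %% 4 = 2)%N -> sum_of_three_squares N.
Proof.
move=> N4; case: (eqVneq N 2%N) => [->|N2]; first by exists 1, 1, 0.
have := @coef_odd_odd_even N _ N (leqnn N) (leqnn _) N4.
have [m hm] : exists m, N = (4 * m + 2)%N by exists (N %/ 4)%N; lia.
set u := (X in 2 * X = _) => e; have : u != 0.
  have : 0 < form_count N.+1 1 N by rewrite {2}hm; apply: form_count1_gt0; lia.
  by rewrite -e; lia.
rewrite /u expr2 -mulrA => /coef_sumX_neq0[i hi] /coef_sumX_neq0[j hj].
rewrite -[even_theta _]mulr1 => /coef_sumX_neq0[y hy].
rewrite coef1 pnatr_eq0 eqb0 negbK => /eqP h.
exists (2 * i%:Z + 1), (2 * j%:Z + 1), (2 * y).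
by rewrite -!odd_sqr_posz -even_sqr_absz; by apply: sub3_eq0.
Qed.
End Theta.

(** * Residues modulo 32 *)

Section ThueMorse.
Local Open Scope ring_scope.

Lemma s2_widen (n N : nat) : (n <= N)%N -> s2 n = (\sum_(i < N) (n %/ 2 ^ i) %% 2)%N.
Proof.
move=> nN; rewrite /s2 (big_ord_widen N (fun i => (n %/ 2 ^ i) %% 2)%N nN) big_mkcond.
apply: eq_bigr => i _; case: ltnP => // ni.
rewrite divn_small ?mod0n //; apply: leq_trans (ltn_expl n (isT : (1 < 2)%N)) _.
by rewrite leq_exp2l.
Qed.

Lemma s2_half n : s2 n = (n %% 2 + s2 (n %/ 2))%N.
Proof.
case: n => [|n]; first by rewrite /s2 !big_ord0.
rewrite [LHS]/s2 big_ord_recl /= expn0 divn1; congr (_ + _)%N.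
rewrite (@s2_widen _ n); last by lia.
by apply: eq_bigr => i _; rewrite /bump /= add1n expnS divnMA.
Qed.

Lemma t_half n : t n = (-1) ^+ (n %% 2) * t (n %/ 2).
Proof. by rewrite /t s2_half exprD. Qed.

Lemma t0 : t 0 = 1.
Proof. by rewrite /t /s2 big_ord0. Qed.

Lemma t_double n : t (2 * n) = t n.
Proof. by rewrite t_half modnMr mulKn // mul1r. Qed.

Lemma t_doubleS n : t (2 * n + 1) = - t n.
Proof.
by rewrite t_half mulnC modnMDl divnMDl // addn0 mulN1r.
Qed.

Lemma t_pm1 n : t n = 1 \/ t n = -1.
Proof. by rewrite /t -signr_odd; case: odd; [right | left]. Qed.

Lemma t_mul (k m l : nat) : (l < 2 ^ k)%N -> t (2 ^ k * m + l) = t m * t l.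
Proof.
elim: k l => [|k IH] l lk.
  have -> : l = 0%N by rewrite expn0 in lk; lia.
  by rewrite expn0 mul1n addn0 t0 mulr1.
rewrite t_half [t l]t_half mulrCA -IH; last by rewrite expnS in lk; lia.
have -> : (2 ^ k.+1 * m + l)%N = ((2 ^ k * m) * 2 + l)%N by rewrite expnS; lia.
by rewrite modnMDl divnMDl.
Qed.

(** Subtracting 1 turns the final digits 10...0 of m into 01...1, so the number of digits 1 changes
    by the valuation minus one. *)
Lemma t_pred m : (0 < m)%N -> t m.-1 = (-1) ^+ (logn 2 m).+1 * t m.
Proof.
elim/ltn_ind: m => m IH m0; case: (boolP (odd m)) => om.
  have hm : m = (2 * m./2 + 1)%N by lia.
  have tm : t m = - t m./2 by rewrite {1}hm t_doubleS.
  have tp : t m.-1 = t m./2 by rewrite -[RHS]t_double; congr t; lia.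
  have l0 : logn 2 m = 0%N by rewrite lognE dvdn2 om /= andbF.
  by rewrite tp tm l0 expr1 mulN1r opprK.
have hm : m = (2 * m./2)%N by lia.
have h0 : (0 < m./2)%N by lia.
have tm : t m = t m./2 by rewrite {1}hm t_double.
have tp : t m.-1 = - t (m./2).-1.
  by rewrite -t_doubleS; congr t; lia.
rewrite tp tm IH //; last by lia.
have -> : logn 2 m = (logn 2 m./2).+1 by rewrite {1}hm lognM // logn_prime.
by rewrite [in RHS]exprS mulN1r mulNr.
Qed.

Definition tpoly (J : nat) : {poly int} := \prod_(j < J) (1 - 'X^(2 ^ j)).

Lemma tpolyS J : tpoly J.+1 = (1 - 'X) * (tpoly J \Po 'X^2).
Proof.
rewrite /tpoly big_ord_recl expn0 expr1; congr (_ * _).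
rewrite rmorph_prod; apply: eq_bigr => i _ /=.
by rewrite rmorphB rmorph1 /= comp_Xn_poly -exprM -expnS.
Qed.

Lemma coef_1subX_comp (p : {poly int}) n :
  ((1 - 'X) * (p \Po 'X^2))`_n = (-1) ^+ (n %% 2) * p`_(n %/ 2).
Proof.
rewrite mulrBl mul1r coefB coefXM !coef_comp_poly_Xn //.
case: n => [|n]; first by rewrite dvdn0 /= subr0 div0n mul1r.
rewrite [(_ == _)]/= [n.+1.-1]/= !dvdn2 /= negbK modn2 /=.
case: (boolP (odd n)) => on /=; first by rewrite subr0 mul1r.
by rewrite sub0r expr1 mulN1r; congr (- _`_ _); lia.
Qed.

Lemma coef_tpoly J n : (n < 2 ^ J)%N -> (tpoly J)`_n = t n.
Proof.
elim: J n => [|J IH] n hn.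
  by have -> : n = 0%N; [rewrite expn0 in hn; lia | rewrite /tpoly big_ord0 coef1 t0].
by rewrite tpolyS coef_1subX_comp IH -?t_half //; rewrite expnS in hn; lia.
Qed.

Lemma tpoly_mod2 J : eqpm 2 (2 ^ J) ((1 - 'X) * tpoly J) 1.
Proof.
elim: J => [|J IH].
  by rewrite /tpoly big_ord0 mulr1 => -[|//] _; rewrite coefB coef1 coefX.
rewrite tpolyS mulrA.
have h := eqpm_compX2 IH; rewrite expnS mul2n.
apply: eqpm_trans (eqpm_trans _ h) _; last by rewrite rmorph1; apply: eqpm_refl.
rewrite rmorphM rmorphB rmorph1 /= comp_polyX; apply: eqpmMr.
by apply: (eqpm_add (r := 'X^2 - 'X)); ring.
Qed.

Lemma tpoly_sqr J : eqpm 8 (2 ^ J) (tpoly J ^+ 2 * (1 - 'X) ^+ 3) (1 + 3 * 'X).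
Proof.
elim: J => [|J IH].
  rewrite /tpoly big_ord0 expr1n mul1r => -[|//] _.
  have -> : (1 - 'X) ^+ 3 = 1 + 'X * (- 3 + 3 * 'X - 'X ^+ 2) :> {poly int} by ring.
  by rewrite !coefD !coef1 coefXM [3 * 'X]mulrC coefXM.
(* The factor (1 + X)^3 completes (1 - X)^3 to (1 - X^2)^3, so the induction hypothesis at X^2
   applies. There remains (1 - X)^2 (1 + 3 X^2) = (1 + X)^3 (1 + 3 X) modulo 8. *)
apply: (@eqpm_cancel _ _ ((1 + 'X) ^+ 3)).
  by rewrite -horner_coef0 !hornerE.
have h := eqpm_compX2 IH; rewrite expnS mul2n.
have -> : (1 + 'X) ^+ 3 * (tpoly J.+1 ^+ 2 * (1 - 'X) ^+ 3) =
   (1 - 'X) ^+ 2 * ((tpoly J ^+ 2 * (1 - 'X) ^+ 3) \Po 'X^2).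
  rewrite tpolyS [in RHS]rmorphM !rmorphXn /= [in X in _ = _ * (_ * X)]rmorphB rmorph1 /= comp_polyX.
  by move: (_ \Po _) => u; ring.
apply: eqpm_trans (eqpmMl _ h) _.
rewrite rmorphD rmorph1 rmorphM /= comp_polyX.
have -> : (3 : {poly int}) \Po 'X^2 = 3 by rewrite -[3]/(3%:R) rmorph_nat.
by apply: (eqpm_add (r := - ('X + 'X ^+ 2 + 2 * 'X ^+ 3))); ring.
Qed.

End ThueMorse.

(** * The generating function of colored binary partitions *)

Section Partitions.
Local Open Scope ring_scope.

(** The ranges of j and e are those of [colored_binary_partitions], so expanding the m-th power runs
    exactly over its multiplicity functions. *)
Definition bpoly (n : nat) : {poly int} := \prod_(j < n.+1) \sum_(e < n.+1) 'X^(e * 2 ^ j).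

Lemma b_coef m n : (b m n)%:Z = (bpoly n ^+ m)`_n.
Proof.
have -> : bpoly n ^+ m = \prod_(p : 'I_n.+1 * 'I_m) \sum_(e < n.+1) 'X^(e * 2 ^ p.1).
  rewrite -(pair_bigA _ (fun (j : 'I_n.+1) (c : 'I_m) => \sum_(e < n.+1) 'X^(e * 2 ^ j))) /=.
  by rewrite -prodrXl; apply: eq_bigr => j _; rewrite prodr_const card_ord.
rewrite bigA_distr_bigA coef_sum /b cardE -sum1_size big_enum /=.
rewrite -natz natr_sum big_mkcond; apply: eq_bigr => f _.
rewrite prodrXr coefXn inE eq_sym; by case: eqP.
Qed.

Lemma bpoly_tpoly n : eqpm 0 n.+1 (bpoly n * tpoly n.+1) 1.
Proof.
rewrite -big_split /=; apply: (big_ind (fun p => eqpm 0 n.+1 p 1)) => [|p q hp hq|j _].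
- exact: eqpm_refl.
- by rewrite -[1](mulr1 1); apply: eqpmM.
have -> : (\sum_(e < n.+1) 'X^(e * 2 ^ j)) * (1 - 'X^(2 ^ j)) = 1 - 'X^(2 ^ j * n.+1) :> {poly int}.
  rewrite exprM -[RHS]opprB subrX1 -mulNr opprB mulrC; congr (_ * _).
  by apply: eq_bigr => e _; rewrite -exprM mulnC.
move=> i ni; rewrite coefB coefXn.
have -> : (i == 2 ^ j * n.+1)%N = false.
  by apply/eqP => e; move: ni; rewrite e; have := expn_gt0 2 j; nia.
by rewrite subr0 subrr.
Qed.

(** Squaring [tpoly_sqr] twice raises the modulus from 8 to 32; it remains to compare (1 + 3 X)^4
    with (1 - X)^3 (1 + 15 X). *)
Lemma tpoly_pow8 J : eqpm 32 (2 ^ J) (tpoly J ^+ 8 * (1 - 'X) ^+ 9) (1 + 15 * 'X).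
Proof.
have h := eqpm_sqr (d := 16) isT (eqpm_sqr (d := 8) isT (@tpoly_sqr J)).
apply: (@eqpm_cancel _ _ ((1 - 'X) ^+ 3)); first by rewrite -horner_coef0 !hornerE.
have -> : (1 - 'X) ^+ 3 * (tpoly J ^+ 8 * (1 - 'X) ^+ 9) =
   ((tpoly J ^+ 2 * (1 - 'X) ^+ 3) ^+ 2) ^+ 2 by move: (tpoly J) => u; ring.
apply: eqpm_trans h _.
by apply: (eqpm_add (r := 3 * 'X ^+ 2 + 2 * 'X ^+ 3 + 3 * 'X ^+ 4)); ring.
Qed.

(** The correction term has degree 7, so it does not reach the indices n >= 8 that matter for k =
    3. *)
Lemma bpoly_pow7 n :
  eqpm 32 n.+1 (bpoly n ^+ 7) ((1 - 'X) ^+ 8 * tpoly n.+1 - 16 * ('X * (1 - 'X) ^+ 6)).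
Proof.
have n2 : (n.+1 <= 2 ^ n.+1)%N by apply: ltnW; apply: ltn_expl.
have hT := eqpm_leq n2 (@tpoly_pow8 n.+1).
have h2 := eqpm_leq n2 (@tpoly_mod2 n.+1).
have hb := eqpm_dvd (dvdz0 32) (@bpoly_tpoly n).
move: (bpoly n) (tpoly n.+1) hT h2 hb => q T hT h2 hb.
apply: (@eqpm_cancel _ _ ((1 - 'X) ^+ 2)); first by rewrite -horner_coef0 !hornerE.
have e1 : eqpm 32 n.+1 (q ^+ 7 * (1 + 15 * 'X)) (T * (1 - 'X) ^+ 9).
  apply: eqpm_trans (eqpmMl _ (eqpm_sym hT)) _.
  have -> : q ^+ 7 * (T ^+ 8 * (1 - 'X) ^+ 9) = (q * T) ^+ 7 * (T * (1 - 'X) ^+ 9) by ring.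
  have := eqpmMr (T * (1 - 'X) ^+ 9) (eqpmX 7 hb).
  by rewrite expr1n mul1r.
(* Modulo 32, (1 + 15 X) (1 - 17 X) = (1 - X)^2. As 1 - 17 X = (1 - X) - 16 X, the second part only
   needs T modulo 2. *)
have e2 := eqpmMr (1 - 17 * 'X) e1.
have e3 : eqpm 32 n.+1 ((1 - 'X) ^+ 2 * q ^+ 7) (q ^+ 7 * (1 + 15 * 'X) * (1 - 17 * 'X)).
  by apply: (eqpm_add (r := 8 * 'X ^+ 2 * q ^+ 7)); ring.
apply: eqpm_trans e3 (eqpm_trans e2 _).
have -> : T * (1 - 'X) ^+ 9 * (1 - 17 * 'X) =
  (1 - 'X) ^+ 10 * T + - (16 * ('X * (1 - 'X) ^+ 8) * ((1 - 'X) * T)) by ring.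
have -> : (1 - 'X) ^+ 2 * ((1 - 'X) ^+ 8 * T - 16 * ('X * (1 - 'X) ^+ 6)) =
  (1 - 'X) ^+ 10 * T + - (16 * ('X * (1 - 'X) ^+ 8) * 1) by ring.
apply: eqpmD; first exact: eqpm_refl.
apply: eqpmN; apply: eqpm16; exact: h2.
Qed.
End Partitions.

(** * Halving the exponent and the index modulo 32 *)

Section Residues.
Local Open Scope ring_scope.

(** Modulo 32, (1 + 15 X)^2 = (1 - X)^2, so squaring [tpoly_pow8] gives (T (1 - X))^16 = 1.
    Multiplying B^(2^k - 1) by (T (1 - X))^(2^k) and using B T = 1 gives the claim. *)
Lemma bpoly_pow k n : (4 <= k)%N ->
  eqpm 32 n.+1 (bpoly n ^+ (2 ^ k - 1)) ((1 - 'X) ^+ (2 ^ k) * tpoly n.+1).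
Proof.
move=> k4; have n2 : (n.+1 <= 2 ^ n.+1)%N by apply: ltnW; apply: ltn_expl.
have hT := eqpm_leq n2 (@tpoly_pow8 n.+1).
have hb := eqpm_dvd (dvdz0 32) (@bpoly_tpoly n).
move: (bpoly n) (tpoly n.+1) hT hb => q T hT hb.
have h1 : eqpm 32 n.+1 ((T * (1 - 'X)) ^+ 16) 1.
  apply: (@eqpm_cancel _ _ ((1 - 'X) ^+ 2)); first by rewrite -horner_coef0 !hornerE.
  have -> : (1 - 'X) ^+ 2 * (T * (1 - 'X)) ^+ 16 = (T ^+ 8 * (1 - 'X) ^+ 9) ^+ 2 by ring.
  apply: eqpm_trans (eqpmX 2 hT) _.
  by apply: (eqpm_add (r := 'X + 7 * 'X ^+ 2)); ring.
have h2 : eqpm 32 n.+1 ((T * (1 - 'X)) ^+ (2 ^ k)) 1.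
  rewrite -(subnKC k4) expnD exprM -[X in eqpm _ _ _ X](expr1n _ (2 ^ (k - 4))).
  exact: eqpmX.
have h3 := eqpmMl (q ^+ (2 ^ k - 1)) (eqpm_sym h2); rewrite mulr1 in h3.
apply: eqpm_trans h3 _.
have k1 : (2 ^ k)%N = (2 ^ k - 1).+1 by have := expn_gt0 2 k; lia.
have -> : q ^+ (2 ^ k - 1) * (T * (1 - 'X)) ^+ (2 ^ k) =
   (q * T) ^+ (2 ^ k - 1) * ((1 - 'X) ^+ (2 ^ k) * T).
  rewrite k1 subn1 /=; move: (2 ^ k - 1)%N => m.
  rewrite [(T * _) ^+ _]exprMn !exprMn [T ^+ _]exprS.
  by ring.
have := eqpmMr ((1 - 'X) ^+ (2 ^ k) * T) (eqpmX (2 ^ k - 1) hb).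
by rewrite expr1n mul1r.
Qed.

Lemma coef_1subX_exp m n : (m < n)%N -> ((1 - 'X) ^+ m : {poly int})`_n = 0.
Proof.
elim: m n => [|m IH] [|n] // mn; first by rewrite expr0 coef1.
by rewrite exprS mulrBl mul1r coefB coefXM /= !IH ?subrr //; lia.
Qed.

(** Four squarings of (1 - X)^2 = 1 - X^2 modulo 2 reach the modulus 32 and consume a factor 2^5 of
    the exponent. *)
Lemma pow_1subX k : (5 <= k)%N ->
  forall n, eqpm 32 n ((1 - 'X) ^+ (2 ^ k)) ((1 - 'X ^+ 2) ^+ (2 ^ k.-1)).
Proof.
move=> k5 n.
have h : eqpm 2 n ((1 - 'X) ^+ 2) (1 - 'X ^+ 2).
  by apply: (eqpm_add (r := 'X ^+ 2 - 'X)); ring.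
have {}h := eqpm_sqr (d := 16) isT (eqpm_sqr (d := 8) isT
  (eqpm_sqr (d := 4) isT (eqpm_sqr (d := 2) isT h))).
have -> : (2 ^ k = 2 * 2 * 2 * 2 * 2 * 2 ^ (k - 5))%N by rewrite -{1}(subnKC k5) expnD.
have -> : (2 ^ k.-1 = 2 * 2 * 2 * 2 * 2 ^ (k - 5))%N.
  by rewrite (_ : k.-1 = 4 + (k - 5))%N ?expnD //; lia.
by rewrite !exprM; apply: eqpmX.
Qed.

Lemma pow16_1subX J :
  eqpm 32 (2 ^ J) ((1 - 'X) ^+ 16 * tpoly J)
    ((1 - 'X ^+ 2) ^+ 8 * tpoly J - 16 * ('X * (1 - 'X) ^+ 13)).
Proof.
have h2 := @tpoly_mod2 J; move: (tpoly J) h2 => T h2.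
(* (1 - X)^16 is expanded as ((1 - X^2)^2 - 4 X (1 - X)^2)^4; r collects the terms divisible by
   32. *)
pose r : {poly int} := 3 * 'X ^+ 2 * (1 - 'X) ^+ 4 * (1 - 'X ^+ 2) ^+ 4
  - 8 * 'X ^+ 3 * (1 - 'X) ^+ 6 * (1 - 'X ^+ 2) ^+ 2 + 8 * 'X ^+ 4 * (1 - 'X) ^+ 8.
have e1 : (1 - 'X) ^+ 16 * T = (1 - 'X ^+ 2) ^+ 8 * T +
    - (16 * ('X * (1 - 'X) ^+ 2 * T) * (1 - 'X ^+ 2) ^+ 6) + 32%:P * (r * T).
  by rewrite /r; ring.
apply: eqpm_trans (eqpm_add e1) _; apply: eqpmD; first exact: eqpm_refl.
apply: eqpmN.
have h : eqpm 2 (2 ^ J) ((1 - 'X ^+ 2) ^+ 6) (((1 - 'X) ^+ 2) ^+ 6).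
  by apply: eqpmX; apply: (eqpm_add (r := 'X - 'X ^+ 2)); ring.
apply: eqpm_trans (eqpm16 _ h) _.
have -> : 16 * ('X * (1 - 'X) ^+ 2 * T) * ((1 - 'X) ^+ 2) ^+ 6 =
  16 * ('X * (1 - 'X) ^+ 13) * ((1 - 'X) * T) by ring.
by rewrite -[X in eqpm _ _ _ X]mulr1; apply: eqpm16.
Qed.

Definition tm_coef k J n : int := ((1 - 'X) ^+ (2 ^ k) * tpoly J)`_n.

(** Modulo 32 the power of 1 - X becomes a polynomial in X^2, and by [tpolyS] only a factor 1 - X is
    left outside X^2. The correction for k = 4 has degree 14, below n >= 16. *)
Lemma tm_coef_half k J n : (4 <= k)%N -> (2 ^ k <= n < 2 ^ J.+1)%N ->
  (32 %| tm_coef k J.+1 n - (-1) ^+ (n %% 2) * tm_coef k.-1 J (n %/ 2))%Z.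
Proof.
move=> k4 /andP[kn nJ].
have h : eqpm 32 n.+1 ((1 - 'X) ^+ (2 ^ k) * tpoly J.+1)
    ((1 - 'X ^+ 2) ^+ (2 ^ k.-1) * tpoly J.+1 - 16 * ('X * (1 - 'X) ^+ 13) *+ (k == 4%N)).
  case: (eqVneq k 4%N) => [->|k4'].
    by apply: eqpm_leq (@pow16_1subX J.+1).
  by rewrite mulr0n subr0; apply: eqpmMr; apply: pow_1subX; lia.
have := h n (ltnSn n); rewrite coefB opprB addrA.
have -> : (16 * ('X * (1 - 'X) ^+ 13) *+ (k == 4%N) : {poly int})`_n = 0.
  case: eqP => [k4'|_]; last by rewrite mulr0n coef0.
  have n16 : (16 <= n)%N by move: kn; rewrite k4'.
  rewrite mulr1n -[16 : {poly int}]/(16%:R) -polyC_natr coefCM coefXM.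
  by rewrite coef_1subX_exp ?if_same ?mulr0 //; lia.
rewrite addr0; congr (_ %| _ - _)%Z; rewrite tpolyS /tm_coef -coef_1subX_comp.
congr (_`_n); rewrite rmorphM rmorphXn rmorphB rmorph1 /= comp_polyX mulrCA.
by [].
Qed.
End Residues.

(** * The residue of b and the equivalences *)

Section Dichotomy.
Local Open Scope ring_scope.

Definition dichotomy k n (c : int) : Prop :=
  (t n = t (n - 2 ^ k) -> (32 %| c + 4 * t n)%Z) /\
  (t n <> t (n - 2 ^ k) -> (4 %| c - 2)%Z).

Lemma tm_coef3E J n : (8 <= n < 2 ^ J)%N ->
  tm_coef 3 J n = t n - 8 * t (n - 1) + 28 * t (n - 2) - 56 * t (n - 3) + 70 * t (n - 4)
    - 56 * t (n - 5) + 28 * t (n - 6) - 8 * t (n - 7) + t (n - 8).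
Proof.
move=> /andP[n8 nJ]; rewrite /tm_coef.
have ct i : (i <= 8)%N -> ('X^i * tpoly J)`_n = t (n - i).
  move=> i8; rewrite coefXnM ltnNge (leq_trans i8 n8) /= coef_tpoly //.
  by apply: leq_ltn_trans nJ; rewrite leq_subr.
have -> : (1 - 'X) ^+ (2 ^ 3) * tpoly J = tpoly J + (-8)%:P * ('X^1 * tpoly J)
  + 28%:P * ('X^2 * tpoly J) + (-56)%:P * ('X^3 * tpoly J) + 70%:P * ('X^4 * tpoly J)
  + (-56)%:P * ('X^5 * tpoly J) + 28%:P * ('X^6 * tpoly J) + (-8)%:P * ('X^7 * tpoly J)
  + 'X^8 * tpoly J.
  by move: (tpoly J) => T; rewrite (_ : 2 ^ 3 = 8)%N // !polyCN; ring.
by rewrite !coefD !coefCM !ct // coef_tpoly //; ring.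
Qed.

(** With n = 8 (u + 1) + v, [t_mul] makes each of the nine values of t equal to t (u + 1) or t u
    times a value at an index below 8; a finite check over v and two signs remains. *)
Lemma dichotomy3 J n : (8 <= n < 2 ^ J)%N -> dichotomy 3 n (tm_coef 3 J n).
Proof.
move=> nJ; rewrite (tm_coef3E nJ).
have n8 : (8 <= n)%N by case/andP: nJ.
have [u [v [hn hv]]] : exists u v, n = (2 ^ 3 * u.+1 + v)%N /\ (v < 2 ^ 3)%N.
  exists (n %/ 8).-1, (n %% 8)%N; lia.
have [e0 e1 e2 e3] : [/\ t 0 = 1, t 1 = -1, t 2 = -1 & t 3 = 1].
  by rewrite /t /s2 !big_ord_recl !big_ord0.
have [e4 e5 e6 e7] : [/\ t 4 = -1, t 5 = 1, t 6 = 1 & t 7 = -1].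
  by rewrite /t /s2 !big_ord_recl !big_ord0.
have tn i : (i <= 8)%N -> t (n - i) = if (i <= v)%N then t u.+1 * t (v - i) else t u * t (8 + v - i).
  move=> i8; case: leqP => iv; rewrite -(t_mul (k := 3)); try lia; congr t; lia.
have tn0 := tn 0%N isT; rewrite subn0 in tn0.
rewrite /dichotomy tn0 !tn //.
have hA := t_pm1 u.+1; have hC := t_pm1 u.
move: (t u.+1) (t u) hA hC => A C hA hC {hn tn tn0}.
case: v hv => [|[|[|[|[|[|[|[|v]]]]]]]] // _;
  repeat match goal with
  | |- context [t (subn ?x ?y)] => let z := eval compute in (subn x y) in change (t (subn x y)) with (t z)
  | |- context [leq ?x ?y] => let z := eval compute in (leq x y) in change (leq x y) with z
  end; cbn iota; rewrite ?e0 ?e1 ?e2 ?e3 ?e4 ?e5 ?e6 ?e7.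
all: abstract (case: hA => ->; case: hC => ->; split; lia).
Qed.

(** Halving multiplies both values of t and, modulo 32, the coefficient by the same sign, and the
    class 2 modulo 4 is stable under sign change; so the claim descends to k = 3. *)
Lemma dichotomy_tm_coef k J n : (3 <= k)%N -> (2 ^ k <= n < 2 ^ J)%N ->
  dichotomy k n (tm_coef k J n).
Proof.
elim: k J n => // k IH J n k3 nJ.
case: (eqVneq k 2%N) => [k2|k2].
  by move: nJ; rewrite k2 => nJ; apply: dichotomy3.
case: J nJ => [|J] nJ.
  by exfalso; case/andP: nJ; have := expn_gt0 2 k.+1; rewrite expn0; lia.
have k4 : (3 < k.+1)%N by lia.
have h := tm_coef_half k4 nJ; rewrite /= in h.
have n2 : (2 ^ k <= n %/ 2 < 2 ^ J)%N by move: nJ; rewrite !expnS; lia.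
have [h1 h2] := IH J (n %/ 2)%N k4 n2.
move: h h1 h2; rewrite /dichotomy.
have -> : t (n - 2 ^ k.+1) = (-1) ^+ (n %% 2) * t (n %/ 2 - 2 ^ k).
  rewrite t_half; congr (_ ^+ _ * t _); rewrite expnS; move: nJ; rewrite !expnS; lia.
rewrite [t n]t_half.
move: (tm_coef _ _ _) (tm_coef _ _ _) => c c'.
have [->|->] : (n %% 2 = 0 \/ n %% 2 = 1)%N by lia.
  rewrite !mul1r => h h1 h2; split=> h3; [have := h1 h3 | have := h2 h3]; lia.
rewrite !mulN1r => h h1 h2; split=> h3.
  by have := h1 (oppr_inj h3); lia.
have : t (n %/ 2) <> t (n %/ 2 - 2 ^ k) by move=> e; apply: h3; rewrite e.
by move/h2; lia.
Qed.

Lemma dichotomy_b k n : (3 <= k)%N -> (2 ^ k <= n)%N -> dichotomy k n (b (2 ^ k - 1) n).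
Proof.
move=> k3 kn.
have nJ : (n < 2 ^ n.+1)%N by apply: ltnW; apply: ltn_expl.
have [h1 h2] := @dichotomy_tm_coef k n.+1 n k3 (introT andP (conj kn nJ)).
have h : (32 %| (b (2 ^ k - 1) n)%:Z - tm_coef k n.+1 n)%Z.
  rewrite b_coef; case: (ltnP 3 k) => k4; first exact: bpoly_pow.
  have k3' : k = 3%N by lia.
  have := @bpoly_pow7 n n (ltnSn n); rewrite k3' /tm_coef.
  rewrite coefB opprB addrA (_ : (16 * _ : {poly int})`_n = 0) ?addr0 //.
  rewrite -[16 : {poly int}]/(16%:R) -polyC_natr coefCM coefXM.
  by rewrite coef_1subX_exp ?if_same ?mulr0 //; move: kn; rewrite k3'; lia.
by split=> h3; [have := h1 h3 | have := h2 h3]; lia.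
Qed.

Lemma sqr_form (u : int) :
  (exists z, u ^+ 2 = 8 * z + 1) \/ (exists2 y, u = 2 * y & u ^+ 2 = 4 * y ^+ 2).
Proof.
have [[y hy]|[y hy]] := int_parity u; last by left; apply: odd_sqr hy.
by right; exists y => //; rewrite hy; ring.
Qed.

(** Modulo 8 all of x, y, z must be even, and division by 4 leaves 7 modulo 8, which three squares
    never give. *)
Lemma not_three_squares N : (N %% 32 = 28)%N -> ~ sum_of_three_squares N.
Proof.
move=> N28 [x [y [z e]]].
have {e} : x ^+ 2 + y ^+ 2 + z ^+ 2 = 32 * (N %/ 32)%N%:Z + 28 by rewrite -e; lia.
have key (u v w q : int) : u ^+ 2 + v ^+ 2 + w ^+ 2 = 8 * q + 7 -> False.
  by have [[? ->]|[? _ ->]] := sqr_form u; have [[? ->]|[? _ ->]] := sqr_form v;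
    have [[? ->]|[? _ ->]] := sqr_form w; lia.
have [[? ->]|[x' _ ->]] := sqr_form x; have [[? ->]|[y' _ ->]] := sqr_form y;
  have [[? ->]|[z' _ ->]] := sqr_form z; try lia.
move=> e; apply: (key x' y' z' (N %/ 32)%N); lia.
Qed.

Lemma sum_of_three_squares_mul4 N : sum_of_three_squares N -> sum_of_three_squares (4 * N).
Proof.
move=> [x [y [z e]]]; exists (2 * x), (2 * y), (2 * z).
by rewrite PoszM e; ring.
Qed.

Lemma b_three_squares k n : (3 <= k)%N -> (2 ^ k <= n)%N ->
  ~ sum_of_three_squares (b (2 ^ k - 1) n) <-> t n = 1 /\ t (n - 2 ^ k) = 1.
Proof.
move=> k3 kn; have [h1 h2] := dichotomy_b k3 kn.
move: (b _ _) h1 h2 => N h1 h2; split=> [nN | [e1 e2]]; last first.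
  by apply: not_three_squares; have := h1 (etrans e1 (esym e2)); rewrite e1; lia.
case: (eqVneq (t n) (t (n - 2 ^ k))) => [e|/eqP ne]; last first.
  by case: nN; apply: three_squares_2mod4; have := h2 ne; lia.
have [e1|e1] := t_pm1 n; first by rewrite -e e1.
(* Here t n = -1, so b is 4 modulo 32 and b / 4 is 1 modulo 8. *)
case: nN; have := h1 e; rewrite e1 => h.
have -> : N = (4 * (N %/ 4))%N by lia.
by apply: sum_of_three_squares_mul4; apply: three_squares_1mod4; lia.
Qed.

Lemma thue_morse_valuation k n : (2 ^ k <= n)%N ->
  t n = 1 /\ t (n - 2 ^ k) = 1 <->
  exists l m : nat, [/\ n = (2 ^ k * m + l)%N, (l < 2 ^ k)%N, t m = t l & (logn 2 m = 1 %[mod 2])%N].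
Proof.
move=> kn; have k0 := expn_gt0 2 k.
(* Passing from n to n - 2^k keeps l and replaces m by m - 1, so [t_pred] brings in the valuation of
   m. *)
have tE m l : (0 < m)%N -> (l < 2 ^ k)%N -> n = (2 ^ k * m + l)%N ->
    t n = t m * t l /\ t (n - 2 ^ k) = (-1) ^+ (logn 2 m).+1 * (t m * t l).
  move=> m0 lk hn; have -> : (n - 2 ^ k = 2 ^ k * m.-1 + l)%N.
    by rewrite hn -{1}(prednK m0) mulnS -addnA addKn.
  by rewrite hn !t_mul // t_pred // mulrA.
have pmE m l : t m * t l = 1 <-> t m = t l.
  by have [->|->] := t_pm1 m; have [->|->] := t_pm1 l.
split=> [[e1 e2]|[l [m [hn lk e /eqP ev]]]].
  exists (n %% 2 ^ k)%N, (n %/ 2 ^ k)%N.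
  have m0 : (0 < n %/ 2 ^ k)%N by rewrite divn_gt0.
  have lk : (n %% 2 ^ k < 2 ^ k)%N by rewrite ltn_mod.
  have hn : n = (2 ^ k * (n %/ 2 ^ k) + n %% 2 ^ k)%N by rewrite mulnC -divn_eq.
  have [h1 h2] := tE _ _ m0 lk hn; split=> //; first by apply/pmE; rewrite -h1.
  move: h2; rewrite -h1 e1 e2 mulr1 -signr_odd /= !modn2.
  by case: odd.
have m0 : (0 < m)%N.
  by rewrite lt0n; apply/eqP => m0; move: kn; rewrite hn m0 muln0 add0n leqNgt lk.
have [-> ->] := tE _ _ m0 lk hn.
have -> : t m * t l = 1 by apply/pmE.
move: ev; rewrite mulr1 -signr_odd /= !modn2.
by case: odd.
Qed.
End Dichotomy.

(* In the third condition n >= 2 ^ k forces m > 0, so logn 2 m is the genuine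
   2-adic valuation; moreover logn 2 0 = 0 is even, so m = 0 is excluded just
   as with the convention that the valuation of 0 is infinite. *)
Theorem corollary5p6 (k n : nat) (hk : 3 <= k) (hn : 2 ^ k <= n) :
  (~ sum_of_three_squares (b (2 ^ k - 1) n) <->
     t n = 1%R /\ t (n - 2 ^ k) = 1%R) /\
  (t n = 1%R /\ t (n - 2 ^ k) = 1%R <->
     exists l m : nat,
       [/\ n = 2 ^ k * m + l, l < 2 ^ k, t m = t l &
           logn 2 m = 1 %[mod 2]]).
Proof. by split; [apply: b_three_squares | apply: thue_morse_valuation]. Qed.
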